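(* Let $F$ be a field with $\operatorname{char} F\neq 2$, fix an algebraic closure of $F$, and let $a\in\dot F\setminus(F^2\cup -F^2)$. Then the element $-a$ is not rigid in $F$ if and only if at least one of the following holds: (1) there exist fields $F\subseteq F(\sqrt a)\subseteq E\subseteq L$ with $E/F$ and $L/F$ Galois, $\operatorname{Gal}(E/F)\cong C$ and $\operatorname{Gal}(L/F)\cong G_1$; (2) there exist fields $F\subseteq F(\sqrt a)\subseteq L$ with $L/F$ Galois, $\operatorname{Gal}(L/F(\sqrt a))\cong DD$ and $\operatorname{Gal}(L/F)\cong G_2$.
   Context: $\dot F=F\setminus\{0\}$; $D_F(q)$ is the set of elements of $\dot F$ represented by the quadratic form $q$, and $\langle 1,c\rangle$ is the form $x_1^2+cx_2^2$. An element $c\in\dot F\setminus(F^2\cup -F^2)$ is rigid if $D_F(\langle 1,c\rangle)=\dot F^2\cup c\dot F^2$. $C$ is the cyclic group of order $4$, $D$ the dihedral group of order $8$. $DD$ is the central product of two copies of $D$: if $g$ is the nontrivial central element of $D$, $DD=(D\times D)/\{1,(g,g)\}$. Commutators: $[\sigma,\tau]=\sigma^{-1}\tau^{-1}\sigma\tau$. $G_1$ is the group generated by $x,y$ with relations $x^4=y^2=1$, $[x,y]^2=1$, $[[x,y],x]^2=1$, and $[[x,y],x]$ commutes with $x$ and $y$. $G_2$ is the group generated by $x,y,z$ with relations $x^2=y^2=z^2=1$, $[x,y]^2=[x,z]^2=[y,z]=1$, $[y,[x,z]]=[z,[x,y]]$, this element having order dividing $2$ and commuting with $x,y,z$. *)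

(* Defs.v *)
From HB Require Import structures.
From mathcomp Require Import all_boot all_order all_algebra.
From mathcomp Require Import fingroup morphism quotient gproduct presentation.
From mathcomp Require Import center extremal.
From mathcomp Require Import falgebra fieldext separable galois.
Set Implicit Arguments. Unset Strict Implicit. Unset Printing Implicit Defensive.
Import GRing.Theory.
Local Open Scope ring_scope.

Definition repr_1c (F : fieldType) (c d : F) : Prop :=
  d != 0 /\ exists x1 x2 : F, d = x1 ^+ 2 + c * x2 ^+ 2.

Definition is_square (F : fieldType) (c : F) : Prop := exists b : F, c = b ^+ 2.

Definition rigid (F : fieldType) (c : F) : Prop :=
  c != 0 /\ ~ is_square c /\ ~ is_square (- c) /\
  forall d : F, repr_1c c d <->
    exists b : F, b != 0 /\ (d = b ^+ 2 \/ d = c * b ^+ 2).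

Local Open Scope group_scope.

(* D = dihedral group of order 8; DD = (D x D) / {1, (g,g)}, g the nontrivial
   central element of D, i.e. the diagonal of Z(D) x Z(D). *)
Definition Dgrp : finGroupType := ('D_8)%type.
Definition DDker : {set (Dgrp * Dgrp)%type} :=
  [set (u, u) | u in 'Z([set: Dgrp])].
Definition DD := ([set: (Dgrp * Dgrp)%type] / DDker)%g.

(* Main.v *)
(* Put K = F(r) with r^2 = a.  Since a and -a are not squares, -a is not rigid iff
   some norm d = u^2 - a v^2 from K lies neither in F^2 nor in -a F^2.

   If -a is not rigid, one finds norms b and c from K with a, b independent modulo
   squares and either c = a (when -1 is a norm) or c = -a independent of a and b.
   After scaling by elements of F, b and c become the norms of beta and 1 - beta
   for a single beta in K.  With s^2 = beta, s'^2 the conjugate of beta,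
   g1^2 = 1 - s^2, g2^2 = 1 - s'^2 and om^2 = (1 - s)(1 - s'), the field
   F(r, s, s', g1, g2, om) is Galois over F.  Lifting the sign changes of r, ss'
   and g1 g2 and correcting the lifts by their commutators yields generators that
   satisfy the defining relations of G_1 (c = a, degree 32) or G_2 (c = -a, degree
   64).  A group with those relations and maximal order has the universal property
   of the presentation: compare it with the subgroup generated by the pairs of
   generators in a direct product.

   Conversely, a morphism from the Galois group to the signed permutations of two
   points is realised by conjugate elements s, s' with s^2 in K, so that (ss')^2 is
   a norm from K.  The cyclic quotient in (1) shows that -1 is a norm up to squares,
   and the dihedral quotients of G_1 and G_2 give norms whose square roots are moved
   by y or z; together they contradict rigidity.  In (2) the group DD is recognised
   inside G_2 because its derived subgroup has order 2. *)

Require Import Defs.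
From HB Require Import structures.
From mathcomp Require Import all_boot all_order all_algebra.
From mathcomp Require Import fingroup morphism quotient gproduct presentation.
From mathcomp Require Import center extremal.
From mathcomp Require Import falgebra fieldext separable galois.
From mathcomp Require Import perm action cyclic commutator ring.
From Stdlib Require Import Classical_Prop.
Set Implicit Arguments. Unset Strict Implicit. Unset Printing Implicit Defensive.
Import GRing.Theory.

Local Open Scope group_scope.

(** * Groups given by generators and relations *)

Definition G1_rel (gT : finGroupType) (x y : gT) :=
  [&& x ^+ 4 == 1, y ^+ 2 == 1, [~ x, y] ^+ 2 == 1, [~ x, y, x] ^+ 2 == 1,
      [~ x, y, x, x] == 1 & [~ x, y, x, y] == 1].

Definition G2_rel (gT : finGroupType) (x y z : gT) :=
  [&& x ^+ 2 == 1, y ^+ 2 == 1, z ^+ 2 == 1, [~ x, y] ^+ 2 == 1,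
      [~ x, z] ^+ 2 == 1, [~ y, z] == 1,
      [~ y, [~ x, z]] == [~ z, [~ x, y]], [~ y, [~ x, z]] ^+ 2 == 1,
      [~ y, [~ x, z], x] == 1, [~ y, [~ x, z], y] == 1
    & [~ y, [~ x, z], z] == 1].

Lemma homg_C4P (gT : finGroupType) (G : {group gT}) :
  reflect (exists x, x ^+ 4 == 1 /\ <[x]> = G) (G \homg Grp (x : x ^+ 4)).
Proof.
apply: (iffP existsP) => [[x /eqP[<- r]] | [x [r <-]]]; exists x => //=.
  by split=> //; apply/eqP.
by rewrite !xpair_eqE eqxx.
Qed.

Fixpoint sat_formula (gT : finGroupType) (e : seq gT) (f : Presentation.formula) :=
  match f with
  | Presentation.Eq2 s t => Presentation.eval e s == Presentation.eval e t
  | Presentation.And f1 f2 => sat_formula e f1 && sat_formula e f2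
  end.

Lemma and_relE (vT : finType) (v1 v2 : vT) r :
  Presentation.and_rel v1 v2 r = (v1 == v2) && r :> bool.
Proof. by case: r => //=; rewrite andbT. Qed.

(* Splitting a tuple equality on a dozen components with [xpair_eqE] makes
   conversion explode, hence this detour through the syntax of formulas. *)
Lemma rel_sat_formula (gT : finGroupType) (e : seq gT) f r :
  Presentation.rel e f r = sat_formula e f && r :> bool.
Proof.
elim: f r => [s t|f1 IH1 f2 IH2] r /=; first exact: and_relE.
by rewrite IH1 IH2 andbA.
Qed.

Lemma homg_G1P (gT : finGroupType) (G : {group gT}) :
  reflect (exists x y, G1_rel x y /\ <[x]> <*> <[y]> = G)
    (G \homg Grp (x : y :
           (x ^+ 4, y ^+ 2, [~ x, y] ^+ 2, [~ x, y, x] ^+ 2,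
            [~ x, y, x, x], [~ x, y, x, y]))).
Proof.
apply: (iffP existsP) => [[[x y]] | [x [y [r <-]]]].
  rewrite /Presentation.env1 and_relE rel_sat_formula andbT /=.
  by case/andP=> /eqP <- r; exists x, y.
exists (x, y).
by rewrite /Presentation.env1 and_relE rel_sat_formula andbT eqxx.
Qed.

Lemma homg_G2P (gT : finGroupType) (G : {group gT}) :
  reflect (exists x y z, G2_rel x y z /\ <[x]> <*> <[y]> <*> <[z]> = G)
    (G \homg Grp (x : y : z :
           (x ^+ 2, y ^+ 2, z ^+ 2, [~ x, y] ^+ 2, [~ x, z] ^+ 2, [~ y, z],
            [~ y, [~ x, z]] = [~ z, [~ x, y]],
            [~ y, [~ x, z]] ^+ 2,
            [~ y, [~ x, z], x], [~ y, [~ x, z], y], [~ y, [~ x, z], z]))).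
Proof.
apply: (iffP existsP) => [[[[x y] z]] | [x [y [z [r <-]]]]].
  rewrite /Presentation.env1 and_relE rel_sat_formula andbT /=.
  by case/andP=> /eqP <- r; exists x, y, z.
exists (x, y, z).
by rewrite /Presentation.env1 and_relE rel_sat_formula andbT eqxx.
Qed.

Lemma commg_pair (gT hT : finGroupType) (x y : gT) (x' y' : hT) :
  [~ (x, x'), (y, y')] = ([~ x, y], [~ x', y']) :> gT * hT.
Proof. by []. Qed.

Lemma expg_pair (gT hT : finGroupType) (x : gT) (x' : hT) n :
  (x, x') ^+ n = (x ^+ n, x' ^+ n) :> gT * hT.
Proof. by elim: n => // n IHn; rewrite !expgS IHn. Qed.

Lemma eqg1_pair (gT hT : finGroupType) (x : gT) (x' : hT) :
  ((x, x') == 1 :> gT * hT) = (x == 1) && (x' == 1).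
Proof. by []. Qed.

Lemma G1_rel_pair (gT hT : finGroupType) (x y : gT) (x' y' : hT) :
  G1_rel x y -> G1_rel x' y' -> G1_rel (x, x') (y, y').
Proof.
rewrite /G1_rel !(commg_pair, expg_pair, eqg1_pair).
by do 5![case/andP=> ->]; move=> ->; do 5![case/andP=> ->]; move=> ->.
Qed.

Lemma G2_rel_pair (gT hT : finGroupType) (x y z : gT) (x' y' z' : hT) :
  G2_rel x y z -> G2_rel x' y' z' -> G2_rel (x, x') (y, y') (z, z').
Proof.
rewrite /G2_rel !(commg_pair, expg_pair, eqg1_pair, xpair_eqE).
by do 10![case/andP=> ->]; move=> ->; do 10![case/andP=> ->]; move=> ->.
Qed.

(** The first projection maps [<<A>>] onto [<<fst @: A>>]. The bound on the orders makes it
    injective, and its inverse followed by the second projection is the morphism. *)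
Lemma morphism_of_graph (gT hT : finGroupType) (A : {set gT * hT}) :
  #|<<A>>| <= #|<<fst @: A>>| ->
  exists f : {morphism <<fst @: A>> >-> hT}, forall u, u \in A -> f u.1 = u.2.
Proof.
move=> leA; pose pr := restrm (subsetT <<A>>) (@fst gT hT).
have prE : [morphism of pr] @* <<A>> = <<fst @: A>>.
  by rewrite morphim_restrm setIid morphim_gen ?subsetT // morphimEsub ?subsetT.
have injpr : 'injm [morphism of pr].
  rewrite -card_im_injm eqn_leq leq_morphim /= -/pr.
  by have := prE; rewrite /= => ->.
have fM : {in <<fst @: A>> &, {morph (fun g => (invm injpr g).2) : u v / u * v}}.
  by move=> u v; rewrite -prE => Du Dv /=; rewrite morphM.
exists (Morphism fM) => u Au /=; have Gu : u \in <<A>> by apply: mem_gen.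
by have := invmE injpr Gu; rewrite /= /pr /restrm /= => ->.
Qed.

Lemma joing_cycle2 (gT : finGroupType) (x y : gT) :
  <[x]> <*> <[y]> = <<[set x; y]>>.
Proof. by rewrite joing_idl joing_idr. Qed.

Lemma joing_cycle3 (gT : finGroupType) (x y z : gT) :
  <[x]> <*> <[y]> <*> <[z]> = <<[set x; y; z]>>.
Proof. by rewrite joing_cycle2 joing_idl joing_idr. Qed.

Lemma norm_gen_conj (gT : finGroupType) (A : {set gT}) (g : gT) :
  {in A, forall u, u ^ g \in <<A>>} -> g \in 'N(<<A>>).
Proof.
move=> Ng; rewrite inE -genJ gen_subG; apply/subsetP => _ /imsetP[u Au ->].
exact: Ng.
Qed.

(** The quotient of [<<g |: A>>] by [<<A>>] is generated by the coset of [g], whose order divides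
    [n]. Iterated along a subnormal series, this bounds the orders below. *)
Lemma card_gen_setU1_le (gT : finGroupType) (A : {set gT}) (g : gT) n :
    0 < n -> g \in 'N(<<A>>) -> g ^+ n \in <<A>> ->
  #|<<g |: A>>| <= n * #|<<A>>|.
Proof.
move=> n_gt0 NAg Agn.
have -> : <<g |: A>> = <<A>> <*> <[g]> by rewrite joing_idl joing_idr setUC.
have sN : <<A>> <*> <[g]> \subset 'N(<<A>>).
  by rewrite join_subG normG cycle_subG.
rewrite -(Lagrange (joing_subl _ _)) mulnC leq_mul2r -card_quotient //.
rewrite quotientYidl ?cycle_subG // /quotient morphim_cycle // orbC.
by rewrite (dvdn_leq n_gt0) // order_dvdn -morphX //= coset_id.
Qed.

Lemma invg_involution (gT : finGroupType) (x : gT) : x ^+ 2 = 1 -> x^-1 = x.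
Proof. by move=> x2; apply/eqP; rewrite eq_invg_mul -expg2 x2. Qed.

Lemma commgJ_involution (gT : finGroupType) (x y : gT) :
  y ^+ 2 = 1 -> [~ x, y] ^ y = [~ x, y]^-1.
Proof.
by move=> y2; rewrite commgEl conjMg -conjgM -expg2 y2 conjg1 invMg invgK conjVg.
Qed.

Lemma conjg_commg1 (gT : finGroupType) (x y : gT) : [~ x, y] = 1 -> x ^ y = x.
Proof. by move/eqP/conjg_fixP. Qed.

(** * Orders of groups satisfying the relations of G_1 and G_2 *)

Section G1_order.

Variables (gT : finGroupType) (x y : gT).
Hypothesis rel_xy : G1_rel x y.

Let c := [~ x, y].
Let d := [~ c, x].
(** The normal closure of [y]; the quotient by it is cyclic, generated by the coset of [x]. Its
    fixed field will be the cyclic quartic field. *)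
Definition G1_kernel := <<y |: (c |: [set d])>>.

(** Adjoin [d], [c], [y], [x] in turn. Each normalises the group generated before it, and the
    factors have order at most 2, 2, 2 and 4. *)
Lemma G1_kernel_bounds :
  [/\ #|G1_kernel| <= 8, x \in 'N(G1_kernel), <<[set x; y]>> = <<x |: G1_kernel>>
    & #|<<[set x; y]>>| <= 32].
Proof.
have := rel_xy; rewrite /G1_rel -/c -/d.
case/and5P=> /eqP x4 /eqP y2 /eqP c2 /eqP d2 /andP[/eqP dx /eqP dy].
have dX := conjg_commg1 dx; have dY := conjg_commg1 dy.
have cV : c^-1 = c by apply: invg_involution.
have cX : c ^ x = c * d by rewrite conjg_mulR.
have cY : c ^ y = c by rewrite commgJ_involution.
have yX : y ^ x = y * c by rewrite conjg_mulR -invgR cV.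
have dC : c \in 'N(<<[set d]>>).
  by apply: groupR; apply: norm_gen_conj => u /set1P->; rewrite (dX, dY) mem_gen ?set11.
set A1 := c |: [set d]; set A2 := y |: A1.
have A1c : c \in <<A1>> by rewrite mem_gen ?setU11.
have A1d : d \in <<A1>> by rewrite mem_gen ?inE ?eqxx ?orbT.
have sA : <<A1>> \subset <<A2>> by rewrite genS ?subsetUr.
have A2c := subsetP sA _ A1c; have A2d := subsetP sA _ A1d.
have A2y : y \in <<A2>> by rewrite mem_gen ?setU11.
have Ny : y \in 'N(<<A1>>).
  by apply: norm_gen_conj => u /setU1P[|/set1P] ->; rewrite ?cY ?dY.
have Nx : x \in 'N(<<A2>>).
  by apply: norm_gen_conj => u /setU1P[|/setU1P[|/set1P]] ->;
    rewrite ?yX ?cX ?dX // groupM.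
have b0 : #|<<[set d]>>| <= 2.
  by rewrite -[<<_>>]/<[d]> [#|_|]/(#[d]) dvdn_leq // order_dvdn d2.
have b1 : #|<<A1>>| <= 2 * 2.
  by apply: leq_trans (leq_mul (leqnn 2) b0); rewrite card_gen_setU1_le ?c2 ?group1.
have b2 : #|<<A2>>| <= 2 * (2 * 2).
  by apply: leq_trans (leq_mul (leqnn 2) b1); rewrite card_gen_setU1_le ?y2 ?group1.
have gE : <<[set x; y]>> = <<x |: G1_kernel>>.
  have Gx : x \in <<[set x; y]>> by rewrite mem_gen ?inE ?eqxx ?orbT.
  have Gy : y \in <<[set x; y]>> by rewrite mem_gen ?inE ?eqxx ?orbT.
  apply/eqP; rewrite eqEsubset !gen_subG; apply/andP; split.
    apply/subsetP=> u /set2P[] ->; first by rewrite mem_gen ?setU11.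
    by rewrite mem_gen // inE A2y orbT.
  rewrite subUset sub1set Gx gen_subG; apply/subsetP.
  by move=> u /setU1P[|/setU1P[|/set1P]] ->; rewrite ?groupR.
split=> //; rewrite gE (leq_trans (card_gen_setU1_le (n := 4) _ _ _)) ?genGid //.
  by rewrite x4 group1.
by rewrite (leq_mul (leqnn 4) b2).
Qed.

End G1_order.

Section G2_order.

Variables (gT : finGroupType) (x y z : gT).
Hypothesis rel_xyz : G2_rel x y z.

(** The normal closure of [y] and [z], of index at most 2; it is the group to be recognised as
    [DD]. *)
Definition G2_core :=
  <<y |: (z |: ([~ x, y] |: ([~ x, z] |: [set [~ y, [~ x, z]]])))>>.

(** Adjoin [w], [q], [p], [z], [y], [x] in turn; each step after [w] at most doubles the order. The
    order of [w] is kept as a factor so that a group of order 64 forces [w] to be nontrivial. *)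
Lemma card_G2_bounds :
  #|<<[set x; y; z]>>| <= 32 * #[[~ y, [~ x, z]]] /\
  #|<<[set x; y; z]>>| <= 2 * #|G2_core|.
Proof.
have := rel_xyz; rewrite /G2_rel.
set p := [~ x, y]; set q := [~ x, z]; set w := [~ y, q].
case/and5P=> /eqP x2 /eqP y2 /eqP z2 /eqP p2 /and5P[/eqP q2 /eqP yz /eqP zp].
move=> /eqP w2 /and3P[/eqP wx /eqP wy /eqP wz].
have wX := conjg_commg1 wx; have wY := conjg_commg1 wy.
have wZ := conjg_commg1 wz.
have pV : p^-1 = p by apply: invg_involution.
have qV : q^-1 = q by apply: invg_involution.
have wV : w^-1 = w by apply: invg_involution.
have pX : p ^ x = p by rewrite -{1}pV invgR commgJ_involution // invgR.
have qX : q ^ x = q by rewrite -{1}qV invgR commgJ_involution // invgR.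
have pY : p ^ y = p by rewrite commgJ_involution.
have qZ : q ^ z = q by rewrite commgJ_involution.
have qY : q ^ y = q * w by rewrite conjg_mulR -invgR wV.
have pZ : p ^ z = p * w by rewrite conjg_mulR -invgR -zp wV.
have zY : z ^ y = z by rewrite conjg_commg1 // -invgR yz invg1.
have yX : y ^ x = y * p by rewrite conjg_mulR -invgR pV.
have zX : z ^ x = z * q by rewrite conjg_mulR -invgR qV.
pose T := [set w]; pose T1 := q |: T; pose T2 := p |: T1.
pose T3 := z |: T2; pose T4 := y |: T3.
have Tw : w \in <<T>> by rewrite mem_gen ?set11.
have sT1 : <<T>> \subset <<T1>> by rewrite genS ?subsetUr.
have sT2 : <<T1>> \subset <<T2>> by rewrite genS ?subsetUr.
have sT3 : <<T2>> \subset <<T3>> by rewrite genS ?subsetUr.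
have sT4 : <<T3>> \subset <<T4>> by rewrite genS ?subsetUr.
have T1w := subsetP sT1 _ Tw; have T2w := subsetP sT2 _ T1w.
have T3w := subsetP sT3 _ T2w; have T4w := subsetP sT4 _ T3w.
have T1q : q \in <<T1>> by rewrite mem_gen ?setU11.
have T2q := subsetP sT2 _ T1q.
have T3q := subsetP sT3 _ T2q; have T4q := subsetP sT4 _ T3q.
have T2p : p \in <<T2>> by rewrite mem_gen ?setU11.
have T3p := subsetP sT3 _ T2p; have T4p := subsetP sT4 _ T3p.
have T3z : z \in <<T3>> by rewrite mem_gen ?setU11.
have T4z := subsetP sT4 _ T3z.
have T4y : y \in <<T4>> by rewrite mem_gen ?setU11.
have Nq : q \in 'N(<<T>>).
  by apply: groupR; apply: norm_gen_conj => u /set1P->; rewrite (wX, wZ).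
have Np : p \in 'N(<<T1>>).
  by apply: groupR; apply: norm_gen_conj => u /setU1P[|/set1P] ->;
    rewrite ?qX ?wX ?qY ?wY // groupM.
have Nz : z \in 'N(<<T2>>).
  by apply: norm_gen_conj => u /setU1P[|/setU1P[|/set1P]] ->;
    rewrite ?pZ ?qZ ?wZ // groupM.
have Ny : y \in 'N(<<T3>>).
  by apply: norm_gen_conj => u /setU1P[|/setU1P[|/setU1P[|/set1P]]] ->;
    rewrite ?zY ?pY ?qY ?wY // groupM.
have Nx : x \in 'N(<<T4>>).
  by apply: norm_gen_conj => u /setU1P[|/setU1P[|/setU1P[|/setU1P[|/set1P]]]] ->;
    rewrite ?yX ?zX ?pX ?qX ?wX // groupM.
have step (A : {set gT}) g n : g \in 'N(<<A>>) -> g ^+ 2 = 1 ->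
    #|<<A>>| <= n * #[w] -> #|<<g |: A>>| <= 2 * n * #[w].
  move=> NAg g2 le_n; rewrite -mulnA; apply: leq_trans (leq_mul (leqnn 2) le_n).
  by rewrite card_gen_setU1_le // g2 group1.
have b0 : #|<<T>>| <= 1 * #[w] by rewrite mul1n.
have b := step _ _ _ Nx x2 (step _ _ _ Ny y2 (step _ _ _ Nz z2
  (step _ _ _ Np p2 (step _ _ _ Nq q2 b0)))).
have sG : #|<<[set x; y; z]>>| <= #|<<x |: T4>>|.
  rewrite subset_leq_card // genS //; apply/subsetP=> u.
  by rewrite !inE -orbA => /or3P[] /eqP->; rewrite eqxx ?orbT.
split; first exact: leq_trans sG b.
apply: leq_trans sG _; rewrite -/(G2_core) card_gen_setU1_le // x2.
exact: group1.
Qed.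

Lemma card_G2_le : #|<<[set x; y; z]>>| <= 32 * #[[~ y, [~ x, z]]].
Proof. by case: card_G2_bounds. Qed.

Lemma card_G2_le64 : #|<<[set x; y; z]>>| <= 64.
Proof.
apply: leq_trans card_G2_le _; rewrite (leq_mul2l 32 _ 2) /=.
by case/and5P: rel_xyz => _ _ _ _ /and5P[_ _ _ w2 _]; rewrite dvdn_leq // order_dvdn.
Qed.

End G2_order.

(** * Groups of maximal order and the universal property of the presentations *)

Lemma homg_of_gen (gT hT : finGroupType) (A : {set gT}) (B : {set hT})
    (f : {morphism <<A>> >-> hT}) : f @: A = B -> <<B>> \homg <<A>>.
Proof.
move=> fA; have <- : f @* <<A>> = <<B>>.
  by rewrite morphim_gen ?subset_gen // morphimEsub ?subset_gen // fA.
exact: morphim_homg.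
Qed.

Lemma morphism_of_graph2 (gT hT : finGroupType) (x y : gT) (x' y' : hT) :
  #|<<[set (x, x'); (y, y')]>>| <= #|<<[set x; y]>>| ->
  exists f : {morphism <<[set x; y]>> >-> hT}, f x = x' /\ f y = y'.
Proof.
set A := [set _; _]; have e : fst @: A = [set x; y] by rewrite imsetU !imset_set1.
move=> le; have := @morphism_of_graph _ _ A; rewrite e => /(_ le)[f fE].
exists f; split; [apply: (fE (x, x')) | apply: (fE (y, y'))];
  by rewrite !inE eqxx ?orbT.
Qed.

Lemma morphism_of_graph3 (gT hT : finGroupType) (x y z : gT) (x' y' z' : hT) :
  #|<<[set (x, x'); (y, y'); (z, z')]>>| <= #|<<[set x; y; z]>>| ->
  exists f : {morphism <<[set x; y; z]>> >-> hT},
    [/\ f x = x', f y = y' & f z = z'].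
Proof.
set A := _ :|: [set (z, z')]; have e : fst @: A = [set x; y; z].
  by rewrite !imsetU !imset_set1.
move=> le; have := @morphism_of_graph _ _ A; rewrite e => /(_ le)[f fE].
exists f; split; [apply: (fE (x, x')) | apply: (fE (y, y')) | apply: (fE (z, z'))];
  by rewrite !inE eqxx ?orbT.
Qed.

Lemma isog_C4 (gT : finGroupType) (x : gT) :
  x ^+ 4 = 1 -> 4 <= #[x] -> <[x]> \isog Grp (x : x ^+ 4).
Proof.
move=> x4 ge4; apply: intro_isoGrp => [|rT H].
  by apply/homg_C4P; exists x; rewrite x4 eqxx.
case/homg_C4P => y [/eqP y4 <-].
have ox : #[x] = 4 by apply/eqP; rewrite eqn_leq ge4 andbT dvdn_leq // order_dvdn x4.
have dv : #[y] %| #[x] by rewrite ox order_dvdn y4.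
by rewrite -(im_eltm dv) morphim_homg.
Qed.

(** Pairs of generators satisfy the relations again, so they generate a group of order at most 32.
    By the lower bound on the order it is the graph of a morphism onto the other model. *)
Lemma isog_G1 (gT : finGroupType) (x y : gT) :
    G1_rel x y -> 32 <= #|<<[set x; y]>>| ->
  <<[set x; y]>> \isog Grp (x : y :
           (x ^+ 4, y ^+ 2, [~ x, y] ^+ 2, [~ x, y, x] ^+ 2,
            [~ x, y, x, x], [~ x, y, x, y])).
Proof.
move=> rxy ge32; apply: intro_isoGrp => [|rT H].
  by apply/homg_G1P; exists x, y; rewrite joing_cycle2.
case/homg_G1P => x' [y' [r' <-]]; rewrite joing_cycle2.
have [|f [fx fy]] := @morphism_of_graph2 _ _ x y x' y'.
  apply: leq_trans ge32; have rr := G1_rel_pair rxy r'.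
  by have [] := G1_kernel_bounds rr.
by apply: (@homg_of_gen _ _ _ _ f); rewrite imsetU !imset_set1 fx fy.
Qed.

Lemma isog_G2 (gT : finGroupType) (x y z : gT) :
    G2_rel x y z -> 64 <= #|<<[set x; y; z]>>| ->
  <<[set x; y; z]>> \isog Grp (x : y : z :
           (x ^+ 2, y ^+ 2, z ^+ 2, [~ x, y] ^+ 2, [~ x, z] ^+ 2, [~ y, z],
            [~ y, [~ x, z]] = [~ z, [~ x, y]],
            [~ y, [~ x, z]] ^+ 2,
            [~ y, [~ x, z], x], [~ y, [~ x, z], y], [~ y, [~ x, z], z])).
Proof.
move=> rxyz ge64; apply: intro_isoGrp => [|rT H].
  by apply/homg_G2P; exists x, y, z; rewrite joing_cycle3.
case/homg_G2P => x' [y' [z' [r' <-]]]; rewrite joing_cycle3.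
have [|f [fx fy fz]] := @morphism_of_graph3 _ _ x y z x' y' z'.
  by apply: leq_trans ge64; apply: card_G2_le64; apply: G2_rel_pair.
by apply: (@homg_of_gen _ _ _ _ f); rewrite !imsetU !imset_set1 fx fy fz.
Qed.

(** The pairs generate a homomorphic image of the presented group, which cannot be larger than
    [<<[set x; y]>>]. Hence any generators satisfying the relations behave like the canonical ones,
    which the bare isomorphism does not say. *)
Lemma isoGrp_G1_morphism (gT hT : finGroupType) (x y : gT) (x' y' : hT) :
    <<[set x; y]>> \isog Grp (x : y :
           (x ^+ 4, y ^+ 2, [~ x, y] ^+ 2, [~ x, y, x] ^+ 2,
            [~ x, y, x, x], [~ x, y, x, y])) ->
    G1_rel x y -> G1_rel x' y' ->
  exists f : {morphism <<[set x; y]>> >-> hT}, f x = x' /\ f y = y'.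
Proof.
move=> isoG rxy r'; apply: morphism_of_graph2; apply: leq_homg.
rewrite isoG; apply/homg_G1P; exists (x, x'), (y, y').
by rewrite joing_cycle2 G1_rel_pair.
Qed.

Lemma isoGrp_G2_morphism (gT hT : finGroupType) (x y z : gT) (x' y' z' : hT) :
    <<[set x; y; z]>> \isog Grp (x : y : z :
           (x ^+ 2, y ^+ 2, z ^+ 2, [~ x, y] ^+ 2, [~ x, z] ^+ 2, [~ y, z],
            [~ y, [~ x, z]] = [~ z, [~ x, y]],
            [~ y, [~ x, z]] ^+ 2,
            [~ y, [~ x, z], x], [~ y, [~ x, z], y], [~ y, [~ x, z], z])) ->
    G2_rel x y z -> G2_rel x' y' z' ->
  exists f : {morphism <<[set x; y; z]>> >-> hT},
    [/\ f x = x', f y = y' & f z = z'].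
Proof.
move=> isoG rxyz r'; apply: morphism_of_graph3; apply: leq_homg.
rewrite isoG; apply/homg_G2P; exists (x, x'), (y, y'), (z, z').
by rewrite joing_cycle3 G2_rel_pair.
Qed.

(** * Dihedral quotients and the central product [DD] *)

Section Dihedral8.

Variables (gT : finGroupType) (x y : gT).
Hypotheses (x2 : x ^+ 2 = 1) (y2 : y ^+ 2 = 1) (xy4 : (x * y) ^+ 4 = 1).

Let xV := invg_involution x2.
Let yV := invg_involution y2.

Lemma dihedral_commg : [~ x, y] = (x * y) ^+ 2.
Proof. by rewrite commgEl conjgE xV yV expg2 !mulgA. Qed.

Let c2 : [~ x, y] ^+ 2 = 1.
Proof. by rewrite dihedral_commg -expgM. Qed.

Let cV := invg_involution c2.

Let cx : [~ x, y, x] = 1.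
Proof.
by apply/eqP/conjg_fixP; rewrite -{1}cV invgR commgJ_involution // invgR.
Qed.

Lemma dihedral_G1_rel : G1_rel x y.
Proof.
have x4 : x ^+ 4 = 1 by rewrite -[4]/(2 * 2)%N expgM x2 expg1n.
by rewrite /G1_rel x4 y2 c2 cx !comm1g expg1n eqxx.
Qed.

(** Sending one of [y] and [z] to 1 gives two dihedral quotients of G_2, both killing [[~ y,
    [~ x, z]]]. *)
Lemma dihedral_G2_rel_l : G2_rel x y 1.
Proof.
by rewrite /G2_rel x2 y2 c2 !(commg1, comm1g) !expg1n !(commg1, comm1g, eqxx).
Qed.

Lemma dihedral_G2_rel_r : G2_rel x 1 y.
Proof.
by rewrite /G2_rel x2 y2 c2 !(commg1, comm1g) !expg1n !(commg1, comm1g, eqxx).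
Qed.

End Dihedral8.

Lemma D8_structure :
  [/\ #|[set: Dgrp]| = 8, #|'Z([set: Dgrp])| = 2
    & [set: Dgrp]^`(1) = 'Z([set: Dgrp])].
Proof.
have isoD : [set: Dgrp] \isog 'D_(2 ^ 3) by apply: isog_refl.
have [[x y] genG _] := @generators_2dihedral _ [set: Dgrp]%G 3 isT isoD.
have [_ [G'E _ _ _] _ _ [ZE oZ _ _ _]] :=
  @dihedral2_structure _ [set: Dgrp]%G 3 x y isT genG isoD.
split=> //; last by rewrite G'E ZE.
by rewrite (card_isog isoD) (@card_2dihedral 3).
Qed.

Lemma DDker_group_set : group_set DDker.
Proof.
apply/group_setP; split=> [|_ _ /imsetP[u Zu ->] /imsetP[v Zv ->]].
  by apply/imsetP; exists 1; rewrite ?group1.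
by apply/imsetP; exists (u * v); rewrite ?groupM.
Qed.

Canonical DDker_group := group DDker_group_set.

Lemma card_DDker : #|DDker| = 2.
Proof.
by have [_ <- _] := D8_structure; rewrite card_imset // => u v [].
Qed.

Lemma DDker_center : DDker \subset 'Z([set: Dgrp * Dgrp]).
Proof.
apply/subsetP=> _ /imsetP[u /centerP[_ cu] ->]; apply/centerP; split; rewrite ?inE //.
by move=> [v w] _; congr (_, _); apply: cu; rewrite inE.
Qed.

Lemma DDker_norm (A : {set Dgrp * Dgrp}) : A \subset 'N(DDker).
Proof.
apply: subset_trans (subsetT A) _; apply: cents_norm.
by rewrite centsC (subset_trans DDker_center) // subsetIr.
Qed.

Lemma card_DD : #|DD| = 32.
Proof.
rewrite card_quotient ?DDker_norm // -divgS ?subsetT // card_DDker.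
have [oD _ _] := D8_structure; rewrite cardsT card_prod -!cardsT.
by rewrite [X in (X * X)%N]oD.
Qed.

(** The derived subgroup of D x D lies in the product of the centres, of order 4, and [DDker] is a
    subgroup of order 2 of that product. *)
Lemma card_DD_der1 : #|DD^`(1)| <= 2.
Proof.
have [_ oZ D'Z] := D8_structure; set Z := 'Z(_) in oZ D'Z.
rewrite -quotient_der ?DDker_norm //.
have sG' : [set: Dgrp * Dgrp]^`(1) \subset setX Z Z.
  rewrite derg1 gen_subG; apply/subsetP=> _ /imset2P[[u v] [u' v'] _ _ ->].
  by rewrite commg_pair in_setX /= -/Z -D'Z !derg1 !mem_commg ?inE.
have sK : DDker \subset setX Z Z.
  by apply/subsetP=> _ /imsetP[u Zu ->]; rewrite in_setX Zu.
apply: leq_trans (subset_leq_card (quotientS _ sG')) _.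
rewrite card_quotient ?DDker_norm // -divgS // card_DDker cardsX.
by rewrite oZ.
Qed.

(* The points (true, _) and (false, _) stand for the field elements +-s and +-s'
   below, the second component being true for the sign +. *)
Notation sgnpt := (bool * bool)%type.

Lemma flip_inj : injective (fun u : sgnpt => (u.1, ~~ u.2)).
Proof. by move=> [[] []] [[] []]. Qed.
Lemma swap_inj : injective (fun u : sgnpt => (~~ u.1, u.2)).
Proof. by move=> [[] []] [[] []]. Qed.
Lemma neg_inj : injective (fun u : sgnpt => (u.1, u.2 (+) u.1)).
Proof. by move=> [[] []] [[] []]. Qed.

(** The permutations commuting with [flip] are the signed permutations of [s] and [s']. They form a
    dihedral group of order 8 generated by the exchange [swap] and by [neg], which changes the sign
    of [s] only. *)
Definition flip := perm flip_inj.
Definition swap := perm swap_inj.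
Definition neg := perm neg_inj.

Lemma swap2 : swap ^+ 2 = 1.
Proof. by apply/permP => -[[] []]; rewrite expg2 !permE /= !permE. Qed.

Lemma neg2 : neg ^+ 2 = 1.
Proof. by apply/permP => -[[] []]; rewrite expg2 !permE /= !permE. Qed.

Lemma swap_neg4 : (swap * neg) ^+ 4 = 1.
Proof. by apply/permP => -[[] []]; rewrite !expgS expg0 mulg1 !permM !permE. Qed.

Lemma swap_flip : commute swap flip.
Proof. by apply/permP => -[[] []]; rewrite !permM !permE. Qed.

Lemma neg_flip : commute neg flip.
Proof. by apply/permP => -[[] []]; rewrite !permM !permE. Qed.

Lemma commg_swap_neg_neq1 : [~ swap, neg] != 1.
Proof.
rewrite (dihedral_commg swap2 neg2); apply/eqP => /permP/(_ (true, true)).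
by rewrite expg2 !permM !permE.
Qed.

(** * The group [DD] inside G_2 *)

Lemma index2_mulg (gT : finGroupType) (G H : {group gT}) (u v : gT) :
    H \subset G -> #|G : H| = 2 -> u \in G -> v \in G ->
  u \notin H -> v \notin H -> u * v \in H.
Proof.
move=> sHG iH Gu Gv Hu Hv.
have Gv' : v^-1 \in G :\: H by rewrite inE !groupV Hv.
have := rcoset_index2 sHG iH Gv' => /setP/(_ u).
by rewrite mem_rcoset invgK inE Hu Gu => ->.
Qed.

Lemma index2_commg (gT : finGroupType) (G H : {group gT}) (u v : gT) :
  H \subset G -> #|G : H| = 2 -> u \in G -> v \in G -> [~ u, v] \in H.
Proof.
move=> sHG iH Gu Gv; have /andP[_ nHG] := index2_normal sHG iH.
have nH w : w \in G -> w \in 'N(H) by apply: (subsetP nHG).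
have [Hu|Hu] := boolP (u \in H).
  by rewrite commgEl groupM ?groupV // memJ_norm ?nH.
have [Hv|Hv] := boolP (v \in H).
  by rewrite commgEr groupM // memJ_norm ?groupV ?nH.
by rewrite commgEl conjgE !mulgA -mulgA groupM // (index2_mulg sHG iH) ?groupV.
Qed.

Section G2_maximal.

Variables (gT : finGroupType) (x y z : gT).
Hypothesis rel_xyz : G2_rel x y z.
Let G := <<[set x; y; z]>>.
Hypothesis isoG : G \isog Grp (x : y : z :
           (x ^+ 2, y ^+ 2, z ^+ 2, [~ x, y] ^+ 2, [~ x, z] ^+ 2, [~ y, z],
            [~ y, [~ x, z]] = [~ z, [~ x, y]],
            [~ y, [~ x, z]] ^+ 2,
            [~ y, [~ x, z], x], [~ y, [~ x, z], y], [~ y, [~ x, z], z])).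

Let Gx : x \in G. Proof. by rewrite mem_gen ?inE ?eqxx. Qed.
Let Gy : y \in G. Proof. by rewrite mem_gen ?inE ?eqxx ?orbT. Qed.
Let Gz : z \in G. Proof. by rewrite mem_gen ?inE ?eqxx ?orbT. Qed.

Variable H : {group gT}.
Hypotheses (sHG : H \subset G) (iH : #|G : H| = 2) (isoH : H \isog DD).

Let p := [~ x, y].
Let q := [~ x, z].
Let w := [~ y, q].

(* Two dihedral quotients detect [p] and [q] modulo [w], and [w] itself is
   detected by the order; a maximal subgroup whose derived group has order 2
   cannot contain commutators of both kinds. *)
Lemma G2_maximal_DD : [/\ x \notin H, y \in H & z \in H].
Proof.
have oH : #|H| = 32 by rewrite (card_isog isoH) card_DD.
(* With [w] trivial the whole group would have order at most 32, but its order is twice 32. *)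
have w_neq1 : w != 1.
  rewrite -order_gt1 ltnNge; apply/negP => ow.
  have := leq_trans (card_G2_le rel_xyz) (leq_mul (leqnn 32) ow).
  by rewrite -/G -(Lagrange sHG) iH oH.
have H'le : #|H^`(1)| <= 2.
  by rewrite (card_isog (isog_der 1 isoH)) card_DD_der1.
have H'w u : w \in H^`(1) -> u \in H^`(1) -> u = 1 \/ u = w.
  move=> H'w H'u; have [->|u1] := eqVneq u 1; first by left.
  have [->|uw] := eqVneq u w; first by right.
  have sH' : 1 |: [set w; u] \subset H^`(1).
    by apply/subsetP=> v /setU1P[|/set2P[]] ->; rewrite ?group1.
  have := leq_trans (subset_leq_card sH') H'le.
  by rewrite cardsU1 cards2 !inE negb_or ![1 == _]eq_sym w_neq1 u1 eq_sym uw.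
have := rel_xyz; rewrite /G2_rel -/p -/q -/w.
case/and5P=> /eqP x2 /eqP y2 /eqP z2 /eqP p2 /and5P[/eqP q2 /eqP yz /eqP zp].
move=> /eqP w2 /and3P[/eqP wx /eqP wy /eqP wz].
have qV := invg_involution q2.
have xq : [~ x, q] = 1.
  rewrite -invgR; apply/eqP; rewrite eq_invg1; apply/conjg_fixP.
  by rewrite -{1}qV invgR commgJ_involution // invgR.
have zq : [~ z, q] = 1.
  rewrite -invgR; apply/eqP; rewrite eq_invg1; apply/conjg_fixP.
  by rewrite commgJ_involution.
have wY := conjg_commg1 wy; have wZ := conjg_commg1 wz.
have [fy [fyx fyy fyz]] := isoGrp_G2_morphism isoG rel_xyz
  (dihedral_G2_rel_l swap2 neg2 swap_neg4).
have [fz [fzx fzy fzz]] := isoGrp_G2_morphism isoG rel_xyz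
  (dihedral_G2_rel_r swap2 neg2 swap_neg4).
have fyw : fy w = 1 by rewrite !morphR ?groupR // fyz !commg1.
have fzw : fz w = 1 by rewrite !morphR ?groupR // fzy comm1g.
have H'R u v : u \in H -> v \in H -> [~ u, v] \in H^`(1).
  by move=> Hu Hv; rewrite derg1 mem_commg.
have Hp : p \in H by apply: index2_commg iH _ _.
have Hq : q \in H by apply: index2_commg iH _ _.
(* A commutator of elements of [H] is 1 or [w], so a morphism killing [w] kills it as well. *)
have clash (f : {morphism G >-> {perm sgnpt}}) u v : f w = 1 -> w \in H^`(1) ->
    u \in H -> v \in H -> [~ f u, f v] != 1 -> False.
  move=> fw H'w' Hu Hv; have Gu := subsetP sHG u Hu; have Gv := subsetP sHG v Hv.
  rewrite -morphR //.
  by have [->|->] := H'w _ H'w' (H'R _ _ Hu Hv); rewrite ?morph1 ?fw eqxx.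
have nt := commg_swap_neg_neq1.
have nt' : [~ neg, swap] != 1 by rewrite -invgR eq_invg1.
have mulH u v : u \in G -> v \in G -> u \notin H -> v \notin H -> u * v \in H.
  exact: index2_mulg.
(* In every case but the claimed one, [H] contains two elements, each a generator or a product of
   two generators outside [H], whose images do not commute in a dihedral quotient, and [w] is a
   commutator of elements of [H]. *)
have [Hx|Hx] := boolP (x \in H).
  have [Hy|Hy] := boolP (y \in H).
    by case: (clash fy x y); rewrite ?fyx ?fyy // H'R.
  have [Hz|Hz] := boolP (z \in H).
    by case: (clash fz x z); rewrite ?fzx ?fzz // -/w zp H'R.
  have Hyz := mulH _ _ Gy Gz Hy Hz.
  have fyyz : fy (y * z) = neg by rewrite morphM // fyy fyz mulg1.
  case: (clash fy x (y * z)); rewrite ?fyx ?fyyz //.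
  by have := H'R _ _ Hyz Hq; rewrite commMgJ zq mulg1 -/w wZ.
have fyxz : fy (x * z) = swap by rewrite morphM // fyx fyz mulg1.
have [Hy|Hy] := boolP (y \in H).
  have [//|Hz] := boolP (z \in H).
  have Hxz := mulH _ _ Gx Gz Hx Hz.
  by case: (clash fy y (x * z)); rewrite ?fyxz ?fyy // H'R.
have Hxy := mulH _ _ Gx Gy Hx Hy.
have H'wxy : w \in H^`(1).
  by have := H'R _ _ Hxy Hq; rewrite commMgJ xq conj1g mul1g.
have [Hz|Hz] := boolP (z \in H).
  have fzxy : fz (x * y) = swap by rewrite morphM // fzx fzy mulg1.
  by case: (clash fz (x * y) z); rewrite ?fzxy ?fzz.
have Hxz := mulH _ _ Gx Gz Hx Hz.
have fyxy : fy (x * y) = swap * neg by rewrite morphM // fyx fyy.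
case: (clash fy (x * y) (x * z)); rewrite ?fyxy ?fyxz //.
by rewrite commMgJ commgg conj1g mul1g.
Qed.

End G2_maximal.

(** The centre of the dihedral group is its derived subgroup, of order 2, so its image contains the
    nontrivial [[~ x, y]], which must be the image of the central involution. *)
Lemma homg_dihedral8 (gT : finGroupType) (x y : gT) :
    x ^+ 2 = 1 -> y ^+ 2 = 1 -> (x * y) ^+ 4 = 1 -> [~ x, y] != 1 ->
  exists f : {morphism [set: Dgrp] >-> gT},
    f @* [set: Dgrp] = <<[set x; y]>> /\
    forall u, u \in 'Z([set: Dgrp]) -> u != 1 -> f u = [~ x, y].
Proof.
move=> x2 y2 xy4 nt.
have : <<[set x; y]>> \homg [set: Dgrp].
  rewrite (@Grp'_dihedral 4) //; apply/existsP; exists (x, y).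
  by rewrite /= !xpair_eqE x2 y2 xy4 joing_cycle2 !eqxx.
case/homgP=> f fE; exists f; split=> // u Zu u1.
have [_ oZ D'Z] := D8_structure.
have ZE : 'Z([set: Dgrp]) = [set 1; u].
  apply/esym/eqP; rewrite eqEcard oZ cards2 eq_sym u1 andbT.
  by apply/subsetP=> v /set2P[] ->; rewrite ?group1.
have : [~ x, y] \in f @* 'Z([set: Dgrp]).
  rewrite -D'Z morphim_der // fE derg1 mem_commg // mem_gen // !inE eqxx //.
  by rewrite orbT.
rewrite ZE morphimEsub ?subsetT // imsetU !imset_set1 morph1 => /set2P[e|//].
by rewrite e eqxx in nt.
Qed.

Section G2_core_DD.

Variables (gT : finGroupType) (x y z : gT).
Hypotheses (rel_xyz : G2_rel x y z) (oG : 64 <= #|<<[set x; y; z]>>|).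

Let p := [~ x, y].
Let q := [~ x, z].
Let w := [~ y, q].

Variable H : {group gT}.
Hypotheses (oH : #|H| = 32) (Hy : y \in H) (Hz : z \in H) (Hp : p \in H)
  (Hq : q \in H).

(* [H] is the central product of the dihedral groups <y, q> and <z, p>. *)
Lemma G2_core_isog_DD : H \isog DD.
Proof.
have := rel_xyz; rewrite /G2_rel -/p -/q -/w.
case/and5P=> /eqP x2 /eqP y2 /eqP z2 /eqP p2 /and5P[/eqP q2 /eqP yz /eqP zp].
move=> /eqP w2 /and3P[/eqP wx /eqP wy /eqP wz].
have w_neq1 : w != 1.
  rewrite -order_gt1 ltnNge; apply/negP => ow.
  have := leq_trans oG (leq_trans (card_G2_le rel_xyz) (leq_mul (leqnn 32) ow)).
  by [].
have cpy : commute p y.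
  by apply/commgP/conjg_fixP; rewrite commgJ_involution // invg_involution.
have cqz : commute q z.
  by apply/commgP/conjg_fixP; rewrite commgJ_involution // invg_involution.
have cqx : commute q x.
  apply/commgP/conjg_fixP; rewrite -{1}(invg_involution q2) invgR.
  by rewrite commgJ_involution // invgR.
have cwx : commute w x by apply/commgP; rewrite wx.
have cwy : commute w y by apply/commgP; rewrite wy.
(* Conjugation by [q] fixes [x] and multiplies [y] by [w], which commutes with [x] and [y]; so it
   fixes [p]. *)
have cpq : commute p q.
  have xq : x ^ q = x by rewrite conjgE -cqx mulKg.
  apply/commgP/conjg_fixP; rewrite conjRg xq conjg_mulR -/w commgMJ.
  have -> : [~ x, w] = 1 by apply/eqP/commgP/commute_sym.
  by rewrite mul1g conjRg !(conjgE _ w) -cwx -cwy !mulKg.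
have cyz : commute y z by apply/commgP; rewrite yz.
have [f1 [f1E f1Z]] : exists f : {morphism [set: Dgrp] >-> gT},
    f @* [set: Dgrp] = <<[set y; q]>> /\
    forall u, u \in 'Z([set: Dgrp]) -> u != 1 -> f u = w.
  apply: homg_dihedral8 => //.
  by rewrite -[4]/(2 * 2)%N expgM -(dihedral_commg y2 q2) -/w w2.
have [f2 [f2E f2Z]] : exists f : {morphism [set: Dgrp] >-> gT},
    f @* [set: Dgrp] = <<[set z; p]>> /\
    forall u, u \in 'Z([set: Dgrp]) -> u != 1 -> f u = w.
  rewrite zp; apply: homg_dihedral8 => //; last by rewrite -zp.
  by rewrite -[4]/(2 * 2)%N expgM -(dihedral_commg z2 p2) -zp w2.
have c12 u v : commute (f1 u) (f2 v).
  have cc : <<[set y; q]>> \subset 'C(<<[set z; p]>>).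
    rewrite gen_subG centsC gen_subG; apply/subsetP=> g /set2P[] ->;
      apply/centP => h /set2P[] ->; by apply: commute_sym.
  have F1 : f1 u \in <<[set y; q]>> by rewrite -f1E mem_morphim ?inE.
  have F2 : f2 v \in <<[set z; p]>> by rewrite -f2E mem_morphim ?inE.
  exact: (centP (subsetP cc _ F1)).
(* The product map is a morphism because the two images commute. It kills [DDker] because both
   factors send the central involution to [w], and [w] has square 1. *)
pose phi (u : Dgrp * Dgrp) := f1 u.1 * f2 u.2.
have phiM : {in [set: Dgrp * Dgrp] &, {morph phi : u v / u * v}}.
  move=> [u1 u2] [v1 v2] _ _; rewrite /phi /= !morphM ?inE //.
  by rewrite -!mulgA; congr (_ * _); rewrite !mulgA (c12 v1 u2).
pose Phi := Morphism phiM.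
have kerPhi : DDker \subset 'ker Phi.
  apply/subsetP=> _ /imsetP[u Zu ->]; apply/kerP; rewrite ?inE //= /phi /=.
  have [->|u1] := eqVneq u 1; first by rewrite !morph1 mulg1.
  by rewrite f1Z // f2Z // -expg2.
have homPhi : Phi @* [set: Dgrp * Dgrp] \homg DD.
  have sK : 'ker (coset DDker) \subset 'ker Phi by rewrite ker_coset.
  have sD : [set: Dgrp * Dgrp] \subset 'dom (coset DDker) by apply: DDker_norm.
  have <- : factm_morphism sK sD @* DD = Phi @* [set: Dgrp * Dgrp].
    exact: morphim_factm.
  exact: morphim_homg.
have PhiE : Phi @* [set: Dgrp * Dgrp] = H.
  apply/eqP; rewrite eqEcard oH; apply/andP; split.
    have s1 : <<[set y; q]>> \subset H.
      by rewrite gen_subG; apply/subsetP=> g /set2P[] ->.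
    have s2 : <<[set z; p]>> \subset H.
      by rewrite gen_subG; apply/subsetP=> g /set2P[] ->.
    apply/subsetP=> _ /morphimP[[u v] _ _ ->] /=; apply: groupM.
      by rewrite (subsetP s1) // -f1E mem_morphim ?inE.
    by rewrite (subsetP s2) // -f2E mem_morphim ?inE.
  (* [G2_core] has index at most 2, hence order at least 32, and its generators lie in the image. *)
  have [_ bG] := card_G2_bounds rel_xyz.
  have /leq_trans -> // : 32 <= #|G2_core x y z|.
    by have := leq_trans oG bG; rewrite (leq_mul2l 2 32).
  rewrite subset_leq_card // gen_subG.
  have P1 g : g \in <<[set y; q]>> -> g \in Phi @* [set: Dgrp * Dgrp].
    rewrite -f1E => /morphimP[u _ _ ->]; apply/morphimP.
    by exists (u, 1); rewrite ?inE //= /phi /= morph1 mulg1.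
  have P2 g : g \in <<[set z; p]>> -> g \in Phi @* [set: Dgrp * Dgrp].
    rewrite -f2E => /morphimP[u _ _ ->]; apply/morphimP.
    by exists (1, u); rewrite ?inE //= /phi /= morph1 mul1g.
  have Py : y \in Phi @* [set: Dgrp * Dgrp] by rewrite P1 ?mem_gen ?inE ?eqxx.
  have Pq : q \in Phi @* [set: Dgrp * Dgrp] by rewrite P1 ?mem_gen ?inE ?eqxx ?orbT.
  have Pz : z \in Phi @* [set: Dgrp * Dgrp] by rewrite P2 ?mem_gen ?inE ?eqxx.
  have Pp : p \in Phi @* [set: Dgrp * Dgrp] by rewrite P2 ?mem_gen ?inE ?eqxx ?orbT.
  apply/subsetP=> g; rewrite -/p -/q -/w.
  by case/setU1P=> [->|/setU1P[->|/setU1P[->|/setU1P[->|/set1P->]]]] //; rewrite groupR.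
by rewrite isogEcard card_DD oH leqnn andbT -PhiE.
Qed.

End G2_core_DD.

Local Close Scope group_scope.
Local Open Scope ring_scope.

(** * Norms obtained from Galois groups *)

Section SquareRootAdjunction.

Variables (F : fieldType) (L : fieldExtType F).
Implicit Types (K : {subfield L}) (x t : L).

Lemma adjoin_degree_sqrt K x : x ^+ 2 \in K -> (adjoin_degree K x <= 2)%N.
Proof.
move=> Kx2; rewrite -ltnS -size_minPoly.
have -> : 3%N = size ('X^2 - (x ^+ 2)%:P) by rewrite size_XnsubC.
apply: dvdp_leq; first by rewrite -size_poly_eq0 size_XnsubC.
apply: minPoly_dvdp; first by rewrite rpredB ?rpredX ?polyOverX ?polyOverC.
by rewrite rootE !hornerE subrr.
Qed.

Lemma dim_adjoin_sqrt K x :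
  x \notin K -> x ^+ 2 \in K -> \dim <<K; x>> = (2 * \dim K)%N.
Proof.
move=> Kx Kx2; rewrite dim_Fadjoin; congr (_ * _)%N; apply/eqP.
by rewrite eqn_leq adjoin_degree_sqrt // ltn_neqAle eq_sym adjoin_deg_eq1 Kx.
Qed.

End SquareRootAdjunction.

Section CharNot2.

Variables (F : fieldType) (L : fieldExtType F).
Hypothesis ch2 : 2%N \notin [pchar F].

Lemma two_neq0 : 2%:R != 0 :> L.
Proof.
rewrite -[2%:R](rmorph_nat (in_alg L)) fmorph_eq0.
by move: ch2; rewrite !inE.
Qed.

Lemma oppr_neq (t : L) : t != 0 -> - t != t.
Proof.
move=> t0; rewrite -subr_eq0 -opprD oppr_eq0 -mulr2n -mulr_natl mulf_eq0.
by rewrite negb_or two_neq0.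
Qed.

End CharNot2.

Lemma gal_sqr_sign (F : fieldType) (L : splittingFieldType F) (M : {subfield L})
    (g : gal_of M) (r : L) (a : F) : r ^+ 2 = a%:A -> g r = r \/ g r = - r.
Proof.
move=> r2; have : (g r) ^+ 2 == r ^+ 2 by rewrite -rmorphXn /= r2 rmorph_alg.
by rewrite eqf_sqr => /orP[] /eqP; [left | right].
Qed.

Section GaloisGenerators.

Variables (F : fieldType) (L : splittingFieldType F) (M : {subfield L}).
Hypothesis galM1 : galois 1 M.
Variable A : {set gal_of M}.
Hypothesis genA : <<A>>%g = 'Gal(M / 1)%g.

Lemma gen_fixed_base t : t \in M -> {in A, forall g : gal_of M, g t = t} -> t \in 1%VS.
Proof.
move=> Mt fixt; have -> : 1%VS = fixedField 'Gal(M / 1)%g.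
  by apply/esym/galois_fixedField.
have -> : fixedField 'Gal(M / 1)%g = fixedField A.
  rewrite -genA -gal_generated; apply/galois_fixedField; exact: fixedField_galois.
by apply/fixedFieldP.
Qed.

Lemma gen_fixed_scalar t :
  t \in M -> {in A, forall g : gal_of M, g t = t} -> exists k : F, t = k%:A.
Proof. by move=> Mt /(gen_fixed_base Mt)/vlineP. Qed.

(** Half the sum of [s ^+ 2] and [s' ^+ 2], and half their difference divided by [r], are fixed by
    the generators, so they are scalars [u] and [v]. The two squares are then [u + v r] and
    [u - v r]. *)
Lemma norm_of_conjugates (ch2 : 2%N \notin [pchar F]) (a : F) (r s s' : L) :
    a != 0 -> r ^+ 2 = a%:A -> r \in M -> s \in M -> s' \in M ->
    {in A, forall g : gal_of M,
       [/\ g r = r, g (s ^+ 2) = s ^+ 2 & g (s' ^+ 2) = s' ^+ 2] \/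
       [/\ g r = - r, g (s ^+ 2) = s' ^+ 2 & g (s' ^+ 2) = s ^+ 2]} ->
  exists u v : F, (s * s') ^+ 2 = (u ^+ 2 - a * v ^+ 2)%:A.
Proof.
move=> a0 r2 Mr Ms Ms' HA; have n2 := two_neq0 L ch2.
have r0 : r != 0.
  by apply/eqP => r0; move/eqP: r2;
    rewrite r0 expr0n /= eq_sym scaler_eq0 oner_eq0 (negPf a0).
have [|g Ag|u uE] := @gen_fixed_scalar ((s ^+ 2 + s' ^+ 2) / 2%:R).
- by rewrite rpred_div ?rpred_nat ?rpredD ?rpredX.
- rewrite fmorph_div rmorph_nat rmorphD /=.
  by case: (HA g Ag) => -[_ -> ->] //; rewrite addrC.
have [|g Ag|v vE] := @gen_fixed_scalar ((s ^+ 2 - s' ^+ 2) / (2%:R * r)).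
- by rewrite rpred_div ?rpredM ?rpred_nat ?rpredB ?rpredX.
- rewrite fmorph_div rmorphM rmorph_nat rmorphB /=.
  by case: (HA g Ag) => -[-> -> ->] //; rewrite mulrN invrN mulrN -mulNr opprB.
exists u, v; rewrite -[RHS]/(in_alg L _) rmorphB rmorphXn rmorphM rmorphXn /=.
rewrite -uE -vE -r2.
by field; rewrite r0 n2.
Qed.

(* A signed permutation representation of the Galois group on two points is
   realised by field elements [S u], by linear independence of automorphisms. *)
Lemma signed_orbit (f : {morphism <<A>>%g >-> {perm sgnpt}}) :
    {in A, forall g, commute (f g) flip} ->
  exists S : sgnpt -> L,
    [/\ forall u, S u \in M, forall u, S (flip u) = - S u,
        S (true, true) != 0
      & {in 'Gal(M / 1)%g, forall (g : gal_of M) u, g (S u) = S (f g u)}].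
Proof.
(* [eps] reads the sign of a point of the first pair and vanishes on the second. Weighting the
   conjugates of a suitable [e] by [eps], evaluated at the inverse images of [u], gives [S u]. *)
move=> fA; pose eps (u : sgnpt) : L := if u.1 then (-1) ^+ (~~ u.2) else 0.
have epsN u : eps (flip u) = - eps u.
  by rewrite /eps permE; case: u => [[] []] /=; rewrite ?opprK ?oppr0.
have fC g : g \in 'Gal(M / 1)%g -> f g \in 'C[flip]%g.
  rewrite -genA => Gg; apply: subsetP (mem_morphim f Gg Gg).
  rewrite morphim_gen ?subset_gen // gen_subG morphimEsub ?subset_gen //.
  by apply/subsetP=> _ /imsetP[h Ah ->]; exact/cent1P/fA.
pose c u g := eps ((f g)^-1 u)%g.
have [e Me nz] : exists2 e, e \in M &
    \sum_(g in 'Gal(M / 1)%g) c (true, true) g * g e != 0.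
  apply: (@gal_independent_contra _ _ _ _ _ 1%g); rewrite ?group1 //.
  by rewrite /c morph1 invg1 perm1 /eps /= expr0 oner_eq0.
exists (fun u => \sum_(g in 'Gal(M / 1)%g) c u g * g e); split=> //.
- move=> u; apply: rpred_sum => g _; rewrite rpredM ?memv_gal //.
  by rewrite /c /eps; case: ifP => _; rewrite ?rpred0 // rpredX ?rpredN ?rpred1.
- move=> u; rewrite -sumrN; apply: eq_bigr => g Gg; rewrite -mulNr -epsN /c.
  congr (eps _ * _); rewrite -!permM.
  by have /cent1P -> : (f g)^-1%g \in 'C[flip]%g by rewrite groupV fC.
(* Reindex by right multiplication by [h]. Products apply the left factor first, so [h (g e)] is
   [(g * h) e], and in the coefficient [f h] cancels against its inverse. *)
move=> h Gh u; rewrite rmorph_sum /=.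
rewrite [RHS](reindex_acts 'R _ Gh) /=; last first.
  by apply/subsetP=> k Gk; rewrite !inE /=; apply/subsetP => l; rewrite inE /= => Gl;
    rewrite groupM.
apply: eq_bigr => g Gg; rewrite rmorphM galM //; congr (_ * _).
rewrite /=; have -> : h (c u g) = c u g.
  by rewrite /c /eps; case: ifP; rewrite ?rmorph0 ?rmorph_sign.
by rewrite /c -genA in Gg Gh *; rewrite morphM // invMg permM permK.
Qed.

End GaloisGenerators.

Lemma swapE u : swap u = (~~ u.1, u.2). Proof. by rewrite permE. Qed.
Lemma negE u : neg u = (u.1, u.2 (+) u.1). Proof. by rewrite permE. Qed.
Lemma flipE u : flip u = (u.1, ~~ u.2). Proof. by rewrite permE. Qed.

Section SignedNorms.

Variables (F : fieldType) (L : splittingFieldType F) (M : {subfield L}).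
Hypotheses (ch2 : 2%N \notin [pchar F]) (galM1 : galois 1 M).
Variables (A : {set gal_of M}) (a : F) (r : L).
Hypothesis genA : <<A>>%g = 'Gal(M / 1)%g.
Hypotheses (a0 : a != 0) (r2 : r ^+ 2 = a%:A) (Mr : r \in M).

Let AG g : g \in A -> g \in 'Gal(M / 1)%g.
Proof. by move=> Ag; rewrite -genA mem_gen. Qed.

(** Take [t = s * s'] for the elements of [signed_orbit]: exchanging [s] and [s'] fixes [t], and
    [neg] changes its sign. Since [swap] goes with moving [r], the squares of [s] and [s'] are
    conjugate and [t ^+ 2] is a norm. *)
Lemma dihedral_norm (f : {morphism <<A>>%g >-> {perm sgnpt}}) (x : gal_of M) :
    x \in A -> f x = swap ->
    {in A, forall g : gal_of M, f g = swap /\ g r = - r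
        \/ (f g = neg \/ f g = 1%g) /\ g r = r} ->
  exists t u v, [/\ t \in M, t != 0, t ^+ 2 = (u ^+ 2 - a * v ^+ 2)%:A
    & {in A, forall g : gal_of M, g t = if f g == neg then - t else t}].
Proof.
move=> Ax fx fA; have [g Ag|S [MS SN nzS SG]] := signed_orbit genA (f := f).
  have [[-> _]|[[->|->] _]] := fA g Ag; [exact: swap_flip | exact: neg_flip|].
  exact/commute_sym/commute1.
pose s := S (true, true); pose s' := S (false, true).
have xs : x s = s' by rewrite (SG _ (AG Ax)) fx swapE.
have nz' : s' != 0 by rewrite -xs fmorph_eq0.
have sN : S (true, false) = - s by rewrite -SN flipE.
have sN' : S (false, false) = - s' by rewrite -SN flipE.
have fsn : swap == neg = false.
  by apply/eqP => /permP/(_ (true, true)); rewrite swapE negE.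
have f1n : 1%g == neg = false.
  by apply/eqP => /permP/(_ (true, true)); rewrite perm1 negE.
have actA g : g \in A -> [\/ [/\ f g = swap, g r = - r, g s = s' & g s' = s],
    [/\ f g = neg, g r = r, g s = - s & g s' = s']
  | [/\ f g = 1%g, g r = r, g s = s & g s' = s']].
  move=> Ag; rewrite /s /s' !(SG _ (AG Ag)).
  have [[-> ->]|[[->|->] ->]] := fA g Ag; rewrite ?swapE ?negE ?perm1.
  - by constructor 1.
  - by constructor 2.
  - by constructor 3.
have [g Ag|u [v uvE]] :=
    @norm_of_conjugates _ _ _ galM1 _ genA ch2 a r s s' a0 r2 Mr (MS _) (MS _).
  rewrite !rmorphXn /=.
  by case: (actA g Ag) => -[_ -> -> ->]; rewrite ?sqrrN; [right|left|left].
exists (s * s'), u, v; split=> //; first by rewrite rpredM ?MS.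
  by rewrite mulf_neq0.
move=> g Ag; rewrite rmorphM /=.
by case: (actA g Ag) => -[-> _ -> ->]; rewrite ?fsn ?f1n ?eqxx ?mulNr // mulrC.
Qed.

End SignedNorms.

Lemma swap_neg_flip : commute (swap * neg)%g flip.
Proof.
by apply/commute_sym/commuteM; apply: commute_sym;
  [apply: swap_flip | apply: neg_flip].
Qed.

Lemma scalar_inj (F : fieldType) (L : fieldExtType F) :
  injective (fun k : F => k%:A : L).
Proof. exact: (fmorph_inj (in_alg L)). Qed.

Lemma sqrt_scalar (F : fieldType) (L : fieldExtType F) (a : F) (r : L) :
  ~ is_square a -> r ^+ 2 = a%:A -> r \notin 1%VS.
Proof.
move=> nsq r2; apply/negP=> /vlineP[k rk]; apply: nsq; exists k.
by apply: (@scalar_inj _ L); rewrite -r2 rk -[RHS]/(in_alg L _) rmorphXn.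
Qed.

Section C4_case.

Variables (F : fieldType) (L : splittingFieldType F) (E : {subfield L}).
Hypotheses (ch2 : 2%N \notin [pchar F]) (galE1 : galois 1 E).
Variables (a : F) (r : L).
Hypotheses (a0 : a != 0) (nsq : ~ is_square a) (r2 : r ^+ 2 = a%:A) (Er : r \in E).
Hypothesis isoE : ('Gal(E / 1) \isog Grp (x : x ^+ 4))%g.

(** The generator sends [s] to [s'], [s'] to [- s] and [r] to [- r], so [s * s' * r] is a scalar
    [k]. Thus [k ^+ 2] is [a] times a norm, and [- k ^+ 2] is a norm because [- a] is one. The
    elements with square 1 are even powers of the generator, which fix [r]. *)
Lemma C4_norm :
  (exists k u v : F, k != 0 /\ - k ^+ 2 = u ^+ 2 - a * v ^+ 2) /\
  {in 'Gal(E / 1)%g, forall g : gal_of E, (g ^+ 2)%g = 1%g -> g r = r}.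
Proof.
have /homg_C4P[x [/eqP x4 genx]] := isoGrp_hom isoE.
set rot := (swap * neg)%g.
have dv : (#[rot]%g %| #[x]%g)%N.
  have : (<[rot]> \homg 'Gal(E / 1))%g.
    by rewrite isoE; apply/homg_C4P; exists rot; rewrite swap_neg4.
  by move/card_homg; rewrite -genx.
pose f := eltm_morphism dv; have fx : f x = rot by apply: eltm_id.
have xr : x r = - r.
  have [xr|//] := gal_sqr_sign x r2.
  have := sqrt_scalar nsq r2; rewrite (gen_fixed_base galE1 (A := [set x])) //.
  by move=> g /set1P->.
have [g|S [MS SN nzS SG]] := signed_orbit (A := [set x]) genx (f := f).
  by move=> /set1P->; rewrite fx; apply: swap_neg_flip.
have Gx : x \in 'Gal(E / 1)%g by rewrite -genx cycle_id.
pose s := S (true, true); pose s' := S (false, true).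
have xs : x s = s' by rewrite SG // fx permM swapE negE.
have xs' : x s' = - s by rewrite SG // fx permM swapE negE /= -SN flipE.
split; last first.
  move=> g; rewrite -genx => /cycleP[i ->] gi2.
  have rot2 : (rot ^+ 2)%g != 1%g.
    by rewrite -(dihedral_commg swap2 neg2) commg_swap_neg_neq1.
  have oddi : ~~ odd i.
    apply/negP => oi; case/negP: rot2; apply/eqP.
    have := congr1 f gi2; rewrite morph1 -expgM morphX ?cycle_id // fx.
    rewrite -(odd_double_half i) oi -muln2 mulnDl mul1n expgD.
    by rewrite -mulnA mulnC expgM swap_neg4 expg1n mulg1.
  rewrite -(odd_double_half i) (negPf oddi) add0n -mul2n expgM.
  have x2r : (x ^+ 2)%g r = r by rewrite expg2 galM // xr rmorphN /= xr opprK.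
  by elim: (i./2) => [|j IHj]; rewrite ?gal_id // expgS galM // x2r.
have [g|u [v uvE]] := @norm_of_conjugates _ _ _ galE1 [set x] genx ch2 a r s s'
    a0 r2 Er (MS _) (MS _).
  by move=> /set1P->; right; rewrite !rmorphXn /= xr xs xs' sqrrN.
have [||k kE] := @gen_fixed_scalar _ _ _ galE1 [set x] genx (s * s' * r).
- by rewrite !rpredM ?MS.
- by move=> g /set1P->; rewrite !rmorphM /= xs xs' xr; ring.
have nz' : s' != 0 by rewrite -xs fmorph_eq0.
have r0 : r != 0.
  by apply: contraNneq (sqrt_scalar nsq r2) => ->; rewrite mem0v.
exists k, (a * v), u; split.
  apply/eqP => k0; move/eqP: kE; rewrite k0 scale0r !mulf_eq0.
  by rewrite (negPf nzS) (negPf nz') (negPf r0).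
have : k ^+ 2 = (u ^+ 2 - a * v ^+ 2) * a.
  apply: (@scalar_inj _ L); rewrite -![(_)%:A]/(in_alg L _) rmorphXn rmorphM /=.
  by rewrite -kE -uvE -r2 exprMn.
by move=> ->; ring.
Qed.

End C4_case.

(** * Both Galois conditions contradict rigidity *)

Section NotRigid.

Variables (F : fieldType) (a : F).
Hypotheses (ch2 : 2%N \notin [pchar F]) (a0 : a != 0) (nsq : ~ is_square a).

Lemma rigid_norm (u v : F) : rigid (- a) -> u ^+ 2 - a * v ^+ 2 != 0 ->
  exists k, k != 0 /\
    (u ^+ 2 - a * v ^+ 2 = k ^+ 2 \/ u ^+ 2 - a * v ^+ 2 = - a * k ^+ 2).
Proof.
by move=> [_ [_ [_ rig]]] nz; apply/rig; split=> //; exists u, v; rewrite mulNr.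
Qed.

Variable L : splittingFieldType F.

Lemma sqr_scalar_sign (t : L) (k : F) :
  t ^+ 2 = (k ^+ 2)%:A -> t = k%:A \/ t = - k%:A.
Proof.
rewrite -[_%:A]/(in_alg L _) rmorphXn => /eqP; rewrite eqf_sqr.
by case/orP=> /eqP; [left | right].
Qed.

Lemma moved_sqrt (M : {subfield L}) (g : gal_of M) (t : L) (k : F) :
  t != 0 -> g t = - t -> t ^+ 2 = (k ^+ 2)%:A -> False.
Proof.
move=> t0 gt t2; have /eqP := oppr_neq ch2 t0; apply; rewrite -gt.
by case: (sqr_scalar_sign t2) => ->; rewrite ?rmorphN /= rmorph_alg.
Qed.

(** The cyclic quotient and rigidity make -1 a square. The dihedral quotient gives a norm [t ^+ 2]
    with [t] moved by [y]; as [y] fixes [r], neither [t] nor [t * r] can be a scalar, which excludes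
    both classes allowed by rigidity. *)
Lemma G1_not_rigid (r : L) (E M : {subfield L}) :
    r ^+ 2 = a%:A -> (<<1; r>> <= E)%VS -> (E <= M)%VS ->
    galois 1 E -> galois 1 M -> ('Gal(E / 1) \isog Grp (x : x ^+ 4))%g ->
    ('Gal(M / 1%VS) \isog Grp (x : y :
           (x ^+ 4, y ^+ 2, [~ x, y] ^+ 2, [~ x, y, x] ^+ 2,
            [~ x, y, x, x], [~ x, y, x, y])))%g ->
  ~ rigid (- a).
Proof.
move=> r2 srE sEM galE galM1 isoE isoM rig.
have Er : r \in E by apply: (subvP srE); apply: memv_adjoin.
have Mr : r \in M by apply: (subvP sEM).
have [[k [u [v [k0 uvE]]]] inv_r] := C4_norm ch2 galE a0 nsq r2 Er isoE.
(* The norm [- k ^+ 2] lies in F^2 or in -a F^2; in the second case [a] would be a square. *)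
have [i i2] : exists i : F, -1 = i ^+ 2.
  have [|c [c0 cE]] := @rigid_norm u v rig; first by rewrite -uvE oppr_eq0 sqrf_eq0.
  rewrite -uvE in cE; case: cE => cE.
    by exists (c / k); rewrite expr_div_n -cE; field.
  case: nsq; exists (k / c); rewrite expr_div_n.
  by have -> : k ^+ 2 = a * c ^+ 2 by [apply: oppr_inj; rewrite cE mulNr]; field.
have /homg_G1P[x [y [rxy genG]]] := isoGrp_hom isoM.
rewrite joing_cycle2 in genG.
have [Gx Gy] : x \in 'Gal(M / 1)%g /\ y \in 'Gal(M / 1)%g.
  by rewrite -genG !mem_gen // !inE eqxx ?orbT.
have sKEM : (1 <= E <= M)%VS by rewrite sub1v.
have nE : normalField 1 E by case/and3P: galE.
(* The restriction of [y] to [E] has square 1, and such elements of the cyclic group fix [r]. *)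
have yr : y r = r.
  have cE := normalField_cast_eq sKEM nE Gy Er; rewrite -cE.
  apply: inv_r; first by rewrite -(normalField_img galM1 sKEM nE) mem_morphim.
  have y2 : (y ^+ 2)%g = 1%g by case/and5P: rxy => _ /eqP.
  rewrite expg2 -(normalField_castM sKEM nE) // -expg2 y2.
  exact: (morph1 (normalField_cast_morphism sKEM nE)).
have xr : x r = - r.
  have [xr|//] := gal_sqr_sign x r2.
  have := sqrt_scalar nsq r2; rewrite (gen_fixed_base galM1 genG) //.
  by move=> g /set2P[] ->.
rewrite -[galoisG _ _]genG in isoM.
have [f [fx fy]] := isoGrp_G1_morphism isoM rxy (dihedral_G1_rel swap2 neg2 swap_neg4).
have [|||t [u' [v' [Mt t0 t2 tA]]]] :=
    dihedral_norm ch2 galM1 genG a0 r2 Mr (f := f) (x := x).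
- by rewrite !inE eqxx.
- by [].
- by move=> g /set2P[] ->; [left | right; split; [left|]].
have yt : y t = - t by rewrite tA ?inE ?eqxx ?orbT // fy eqxx.
have nz : u' ^+ 2 - a * v' ^+ 2 != 0.
  by apply: contra_neq t0 => uv0; apply/eqP; rewrite -sqrf_eq0 t2 uv0 scale0r.
have [c [c0 []] cE] := rigid_norm rig nz; rewrite cE in t2.
  exact: moved_sqrt t0 yt t2.
have tr2 : (t * r) ^+ 2 = ((a * i * c) ^+ 2)%:A.
  rewrite exprMn t2 r2 -[RHS]/(in_alg L _) -![_%:A]/(in_alg L _) -rmorphM.
  by congr (in_alg L _); rewrite !exprMn -i2; ring.
have r0 : r != 0 by rewrite -sqrf_eq0 r2 scaler_eq0 oner_eq0 orbF.
apply: (@moved_sqrt M y (t * r) _ _ _ tr2); first by rewrite mulf_neq0.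
by rewrite rmorphM /= yt yr mulNr.
Qed.

(** The two dihedral quotients give norms [t ^+ 2] and [t' ^+ 2], with [t] moved by [y] and [t']
    moved by [z]. Rigidity puts both in -a F^2, so [t * t'] is a scalar; but [y] moves [t] and fixes
    [t']. *)
Lemma G2_not_rigid (r : L) (M : {subfield L}) :
    r ^+ 2 = a%:A -> (<<1; r>> <= M)%VS -> galois 1 M ->
    ('Gal(M / <<1; r>>) \isog DD)%g ->
    ('Gal(M / 1%VS) \isog Grp (x : y : z :
           (x ^+ 2, y ^+ 2, z ^+ 2, [~ x, y] ^+ 2, [~ x, z] ^+ 2, [~ y, z],
            [~ y, [~ x, z]] = [~ z, [~ x, y]],
            [~ y, [~ x, z]] ^+ 2,
            [~ y, [~ x, z], x], [~ y, [~ x, z], y], [~ y, [~ x, z], z])))%g ->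
  ~ rigid (- a).
Proof.
move=> r2 srM galM1 isoH isoM rig.
have Mr : r \in M by apply: (subvP srM); apply: memv_adjoin.
have /homg_G2P[x [y [z [rxyz genG]]]] := isoGrp_hom isoM.
rewrite joing_cycle3 in genG.
have sHG : 'Gal(M / <<1; r>>)%g \subset 'Gal(M / 1)%g by apply: galS; apply: sub1v.
have iH : #|'Gal(M / 1) : 'Gal(M / <<1; r>>)|%g = 2%N.
  have gal_r : galois <<1; r>> M by apply: galoisS galM1; rewrite sub1v.
  rewrite -(dim_fixed_galois galM1 sHG); move/galois_fixedField: gal_r => ->.
  rewrite dim_adjoin_sqrt ?dimv1 ?(sqrt_scalar nsq r2) // r2.
  by rewrite rpredZ ?rpred1.
rewrite -[galoisG _ _]genG in isoM.
have [||Hx Hy Hz] := G2_maximal_DD rxyz isoM (H := 'Gal(M / <<1; r>>)%G) _ _ isoH.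
- by rewrite genG.
- by rewrite genG.
have fixr (g : gal_of M) : g \in 'Gal(M / <<1; r>>)%g -> g r = r.
  by move=> Hg; apply: (fixed_gal srM Hg); apply: memv_adjoin.
have yr := fixr _ Hy; have zr := fixr _ Hz.
have xr : x r = - r.
  have [xr|//] := gal_sqr_sign x r2.
  have := sqrt_scalar nsq r2; rewrite (gen_fixed_base galM1 genG) //.
  by move=> g /setUP[/set2P[]|/set1P] ->.
have [fy [fyx fyy fyz]] := isoGrp_G2_morphism isoM rxyz
  (dihedral_G2_rel_l swap2 neg2 swap_neg4).
have [fz [fzx fzy fzz]] := isoGrp_G2_morphism isoM rxyz
  (dihedral_G2_rel_r swap2 neg2 swap_neg4).
have [|||t [u [v [Mt t0 t2 tA]]]] :=
    dihedral_norm ch2 galM1 genG a0 r2 Mr (f := fy) (x := x).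
- by rewrite !inE eqxx.
- by [].
- move=> g /setUP[/set2P[]|/set1P] ->; [by left | by right; split; [left|]|].
  by right; split; [right|].
have [|||t' [u' [v' [Mt' t0' t2' tA']]]] :=
    dihedral_norm ch2 galM1 genG a0 r2 Mr (f := fz) (x := x).
- by rewrite !inE eqxx.
- by [].
- move=> g /setUP[/set2P[]|/set1P] ->; [by left | by right; split; [right|]|].
  by right; split; [left|].
have f1n : 1%g == neg = false.
  by apply/eqP => /permP/(_ (true, true)); rewrite perm1 negE.
have yt : y t = - t by rewrite tA ?inE ?eqxx ?orbT // fyy eqxx.
have zt' : z t' = - t' by rewrite tA' ?inE ?eqxx ?orbT // fzz eqxx.
have yt' : y t' = t' by rewrite tA' ?inE ?eqxx ?orbT // fzy f1n.
have nz : u ^+ 2 - a * v ^+ 2 != 0.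
  by apply: contra_neq t0 => uv0; apply/eqP; rewrite -sqrf_eq0 t2 uv0 scale0r.
have nz' : u' ^+ 2 - a * v' ^+ 2 != 0.
  by apply: contra_neq t0' => uv0; apply/eqP; rewrite -sqrf_eq0 t2' uv0 scale0r.
have [c [c0 []] cE] := rigid_norm rig nz; rewrite cE in t2.
  exact: moved_sqrt t0 yt t2.
have [c' [c0' []] cE'] := rigid_norm rig nz'; rewrite cE' in t2'.
  exact: moved_sqrt t0' zt' t2'.
have tt2 : (t * t') ^+ 2 = ((a * c * c') ^+ 2)%:A.
  rewrite exprMn t2 t2' -[RHS]/(in_alg L _) -![_%:A]/(in_alg L _) -rmorphM.
  by congr (in_alg L _); ring.
apply: (@moved_sqrt M y (t * t') _ _ _ tt2); first by rewrite mulf_neq0.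
by rewrite rmorphM /= yt yt' mulNr.
Qed.

End NotRigid.

(** * Splitting fields and towers of square roots *)

(** Induction on the degree. Whether a proper factor exists is not decidable over a general field,
    hence the excluded middle. *)
Lemma irreducible_factor (F : fieldType) (p : {poly F}) :
  (1 < size p)%N -> exists2 q, q %| p & irreducible_poly q.
Proof.
have [n] := ubnP (size p); elim: n p => // n IHn p lt_pn p_gt1.
have [[q [q1 qp nqp]]|irr] :=
    classic (exists q : {poly F}, [/\ size q != 1%N, q %| p & ~~ (q %= p)]); last first.
  exists p => //; split=> // q q1 qp.
  by have [//|nqp] := boolP (q %= p); case: irr; exists q.
have p0 : p != 0 by rewrite -size_poly_gt0 ltnW.
have q0 : q != 0 by apply: contraTneq qp => ->; rewrite dvd0p.
have lt_qp : (size q < size p)%N.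
  by rewrite ltn_neqAle dvdp_leq // andbT dvdp_size_eqp.
have q_gt1 : (1 < size q)%N by rewrite ltn_neqAle eq_sym q1 size_poly_gt0.
have [|t tq irr_t] := IHn q _ q_gt1; first exact: leq_trans lt_qp _.
by exists t => //; apply: dvdp_trans qp.
Qed.

(** Adjoin a root of an irreducible factor, split the cofactor over the larger field by induction,
    and view the result over [F]. *)
Lemma split_in_extension (F : fieldType) (p : {poly F}) : p != 0 ->
  exists (L : fieldExtType F) (zs : seq L),
    map_poly (in_alg L) p %= \prod_(z <- zs) ('X - z%:P).
Proof.
have [n] := ubnP (size p); elim: n F p => // n IHn F p lt_pn p0.
have [p_le1|p_gt1] := leqP (size p) 1.
  exists F^o, [::]; rewrite big_nil -size_poly_eq1 size_map_poly.
  by rewrite eqn_leq p_le1 size_poly_gt0.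
have [q qp irr_q] := irreducible_factor p_gt1.
have [K _ [x qx _]] := irredp_FAdjoin irr_q.
have /factor_theorem[t pE] : root (map_poly (in_alg K) p) x.
  by rewrite -(divpK qp) rmorphM rootM qx orbT.
have t0 : t != 0.
  by apply: contraNneq p0 => t0; rewrite -(map_poly_eq0 (in_alg K)) pE t0 mul0r.
have [|L [zs tE]] := IHn K t _ t0.
  rewrite -(size_map_poly (in_alg K)) pE size_Mmonic ?monicXsubC // in lt_pn.
  by rewrite size_XsubC addn2 in lt_pn.
exists (baseFieldType L), (x%:A :: zs).
have -> : map_poly (in_alg (baseFieldType L)) p
        = map_poly (in_alg L) (map_poly (in_alg K) p).
  by rewrite -map_poly_comp; apply: eq_map_poly => k; apply: (baseField_scaleE k 1).
rewrite pE rmorphM /= rmorphB /= map_polyX map_polyC big_cons mulrC.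
exact: eqp_mull.
Qed.

(** Cut the extension down to the subfield generated by the roots, which are then transported along
    [iota]. *)
Lemma splitting_field_exists (F : fieldType) (p : {poly F}) : p != 0 ->
  exists (L : splittingFieldType F) (zs : seq L),
    map_poly (in_alg L) p %= \prod_(z <- zs) ('X - z%:P).
Proof.
move=> /split_in_extension[L0 [ys pE]].
pose L1 : fieldExtType F := subvs_of <<1 & ys>>%VS.
pose zs : seq L1 := map (vsproj _) ys.
pose iota := linfun (vsval : L1 -> L0).
have zsE : map iota zs = ys.
  rewrite -map_comp map_id_in // => y ysy.
  by rewrite /= lfunE /= vsprojK ?seqv_sub_adjoin.
have pE1 : map_poly (in_alg L1) p %= \prod_(z <- zs) ('X - z%:P).
  rewrite -(eqp_map iota) -map_poly_comp rmorph_prod /=.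
  rewrite (eq_map_poly (g := in_alg L0)) => [|k]; last exact: rmorph_alg.
  move: pE; rewrite -{1}zsE big_map; congr (_ %= _).
  by apply: eq_bigr => z _; rewrite rmorphB /= map_polyX map_polyC.
have ax : splitting_field_axiom L1.
  exists (map_poly (in_alg L1) p).
    by apply/polyOverP=> i; rewrite coef_map rpredZ ?rpred1.
  exists zs => //; apply/vspaceP=> u; rewrite memvf.
  have : iota u \in (iota @: <<1 & zs>>)%VS.
    by rewrite aimg_adjoin_seq aimg1 zsE lfunE; apply: (valP u).
  by case/memv_imgP=> v zsv; rewrite !lfunE => /val_inj->.
pose L : splittingFieldType F := HB.pack L1 (FieldExt_isSplittingField.Build F L1 ax).
by exists L, zs.
Qed.

Lemma sqrt_of_split (L : fieldType) (zs : seq L) (e : L) :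
  'X^2 - e%:P %| \prod_(z <- zs) ('X - z%:P) -> exists t, t ^+ 2 = e.
Proof.
case/dvdp_prod_XsubC=> m; set s := mask m zs => eq_s.
have : size ('X^2 - e%:P) = size (\prod_(z <- s) ('X - z%:P)) by apply: eqp_size.
rewrite size_XnsubC // size_prod_XsubC; case: s eq_s => // t s eq_s _.
exists t; have : root ('X^2 - e%:P) t.
  by rewrite (eqp_root eq_s) root_prod_XsubC mem_head.
by rewrite rootE !hornerE subr_eq0 => /eqP.
Qed.

(** * Polynomials over [F] for the radicals *)

Definition sqpair (R : comNzRingType) (Y p n : R) := Y ^+ 2 + (- p * Y + n).

(** Here [p] and [n] stand for the sum and product of two squares, and [Z] for [Y - 1]; see
    [sqquadE]. Only symmetric functions of the conjugates enter, so the coefficients lie in [F], and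
    the leading term is a separate summand so that the degree can be read off. *)
Definition sqquad (R : comNzRingType) (Z p n : R) :=
  (Z ^+ 2 - n) ^+ 2 +
    (- (2%:R * p) * Z ^+ 2 + (- (8%:R * n) * Z + (p ^+ 2 - 4%:R * n - 2%:R * n * p))).

Lemma sqpairE (R : comNzRingType) (Y p q : R) :
  sqpair Y (p + q) (p * q) = (Y - p) * (Y - q).
Proof. by rewrite /sqpair; ring. Qed.

Lemma sqquadE (R : comNzRingType) (Y p q : R) :
  sqquad (Y - 1) (p ^+ 2 + q ^+ 2) (p ^+ 2 * q ^+ 2) =
    (Y - (1 - p) * (1 - q)) * (Y - (1 + p) * (1 - q)) *
    ((Y - (1 - p) * (1 + q)) * (Y - (1 + p) * (1 + q))).
Proof. by rewrite /sqquad; ring. Qed.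

Lemma rmorph_sqpair (R S : comNzRingType) (f : {rmorphism R -> S}) Y p n :
  f (sqpair Y p n) = sqpair (f Y) (f p) (f n).
Proof. by rewrite /sqpair rmorphD rmorphXn rmorphD rmorphM rmorphN. Qed.

Lemma rmorph_sqquad (R S : comNzRingType) (f : {rmorphism R -> S}) Z p n :
  f (sqquad Z p n) = sqquad (f Z) (f p) (f n).
Proof.
by rewrite /sqquad !(rmorph_nat, rmorphXn, rmorphN, rmorphM, rmorphD).
Qed.

Section Nonzero.

Variables (F : fieldType) (Z : {poly F}) (p n : F).
Hypothesis szZ : size Z = 3%N.

Let size_low (c d : F) : (size (c%:P * Z + d%:P)%R <= 3)%N.
Proof.
rewrite (leq_trans (size_polyD _ _)) // geq_max mul_polyC.
rewrite (leq_trans (size_scale_leq _ _)) ?szZ //.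
by rewrite (leq_trans (size_polyC_leq1 _)).
Qed.

Let szZ2 : size (Z ^+ 2) = 5%N.
Proof.
have Z2 : Z ^+ 2 != 0 by rewrite expf_eq0 -size_poly_eq0 szZ.
by rewrite (polySpred Z2) size_exp szZ.
Qed.

Lemma sqpair_neq0 : sqpair Z p%:P n%:P != 0.
Proof.
rewrite -size_poly_eq0 /sqpair -polyCN size_polyDl szZ2 //.
by rewrite ltnS (leq_trans (size_low _ _)).
Qed.

Lemma sqquad_neq0 : sqquad Z p%:P n%:P != 0.
Proof.
have szD : size (Z ^+ 2 - n%:P) = 5%N.
  by rewrite size_polyDl ?szZ2 // size_polyN (leq_ltn_trans (size_polyC_leq1 _)).
have szD2 : size ((Z ^+ 2 - n%:P) ^+ 2) = 9%N.
  have D2 : (Z ^+ 2 - n%:P) ^+ 2 != 0 by rewrite expf_eq0 -size_poly_eq0 szD.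
  by rewrite (polySpred D2) size_exp szD.
rewrite -size_poly_eq0 /sqquad size_polyDl szD2 // ltnS.
rewrite (leq_trans (size_polyD _ _)) // geq_max; apply/andP; split.
  rewrite -(rmorph_nat polyC) -polyCM -polyCN mul_polyC.
  by rewrite (leq_trans (size_scale_leq _ _)) ?szZ2.
rewrite -!(rmorph_nat polyC) -polyC_exp -!polyCM -!polyCN -!polyCD.
by rewrite (leq_trans (size_low _ _)).
Qed.

End Nonzero.

(* [sqpair] and [sqquad] are the polynomials over [F] whose roots are the
   conjugates of [s], [g1] and [om]. *)
Lemma radicals_exist (F : fieldType) (a u v : F) :
  exists (L : splittingFieldType F) (r s s' g1 g2 om : L),
    [/\ r ^+ 2 = a%:A, s ^+ 2 = u%:A + v%:A * r, s' ^+ 2 = u%:A - v%:A * r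
      & [/\ g1 ^+ 2 = 1 - s ^+ 2, g2 ^+ 2 = 1 - s' ^+ 2
          & om ^+ 2 = (1 - s) * (1 - s')]].
Proof.
pose n := u ^+ 2 - a * v ^+ 2; pose Y : {poly F} := 'X^2; pose Z : {poly F} := 'X^2 - 1.
(* The four factors supply square roots of [a], of the conjugates [be] and [be'], of [1 - be] and
   [1 - be'], and of [(1 - s) * (1 - s')]. *)
pose p1 : {poly F} := 'X^2 - a%:P.
pose p2 := sqpair Y (2%:R * u)%:P n%:P; pose p3 := sqpair Z (- (2%:R * u))%:P n%:P.
pose p4 := sqquad Z (2%:R * u)%:P n%:P.
have szZ : size Z = 3%N by rewrite size_XnsubC.
have p_neq0 : p1 * p2 * (p3 * p4) != 0.
  rewrite !mulf_neq0 ?sqpair_neq0 ?sqquad_neq0 ?size_polyXn //.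
  by rewrite -size_poly_eq0 size_XnsubC.
have [L [zs pE]] := splitting_field_exists p_neq0.
have rootL (e : L) q : q %| p1 * p2 * (p3 * p4) ->
    'X^2 - e%:P %| map_poly (in_alg L) q -> exists t, t ^+ 2 = e.
  move=> qp eq; apply: (@sqrt_of_split _ zs); rewrite -(eqp_dvdr _ pE).
  by apply: dvdp_trans eq _; rewrite dvdp_map.
have [r r2] : exists r : L, r ^+ 2 = a%:A.
  apply: (rootL _ p1); first by rewrite -mulrA dvdp_mulr.
  by rewrite rmorphB /= map_polyXn map_polyC.
have mY : map_poly (in_alg L) Y = 'X^2 by rewrite map_polyXn.
have mZ : map_poly (in_alg L) Z = 'X^2 - 1 by rewrite rmorphB /= map_polyXn rmorph1.
pose be : L := u%:A + v%:A * r; pose be' : L := u%:A - v%:A * r.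
have sumE : (2%:R * u)%:A = be + be' :> L.
  by rewrite -[LHS]/(in_alg L _) rmorphM rmorph_nat /= /be /be'; ring.
have prodE : n%:A = be * be' :> L.
  rewrite -[LHS]/(in_alg L _) /n rmorphB rmorphXn rmorphM rmorphXn /= -r2 /be /be';
    ring.
have p2E : map_poly (in_alg L) p2 = ('X^2 - be%:P) * ('X^2 - be'%:P).
  by rewrite rmorph_sqpair /= !map_polyC mY /= sumE prodE polyCD polyCM sqpairE.
have p3E : map_poly (in_alg L) p3 =
    ('X^2 - (1 - be)%:P) * ('X^2 - (1 - be')%:P).
  rewrite rmorph_sqpair /= !map_polyC mZ /= scaleNr sumE prodE (polyCB 1 be) (polyCB
    1 be').
  rewrite polyCN polyCD polyCM polyC1.
  by rewrite /sqpair; ring.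
have [s s2] : exists s : L, s ^+ 2 = be.
  apply: (rootL _ p2); first by rewrite mulrAC dvdp_mull.
  by rewrite p2E dvdp_mulr.
have [s' s'2] : exists s : L, s ^+ 2 = be'.
  apply: (rootL _ p2); first by rewrite mulrAC dvdp_mull.
  by rewrite p2E dvdp_mull.
have [g1 g12] : exists s : L, s ^+ 2 = 1 - be.
  apply: (rootL _ p3); first by rewrite dvdp_mull // dvdp_mulr.
  by rewrite p3E dvdp_mulr.
have [g2 g22] : exists s : L, s ^+ 2 = 1 - be'.
  apply: (rootL _ p3); first by rewrite dvdp_mull // dvdp_mulr.
  by rewrite p3E dvdp_mull.
have [om om2] : exists om : L, om ^+ 2 = (1 - s) * (1 - s').
  apply: (rootL _ p4); first by rewrite !dvdp_mull.
  rewrite rmorph_sqquad /= !map_polyC mZ /= sumE prodE -s2 -s'2.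
  rewrite polyCD (polyCM (s ^+ 2)) (polyCM (1 - s)) !polyC_exp !polyCB polyC1 sqquadE
    -!mulrA.
  exact: dvdp_mulr.
by exists L, r, s, s', g1, g2, om; rewrite g12 g22 om2 s2 s'2.
Qed.

Section SquareRootTowers.

Variables (F : fieldType) (L : fieldExtType F).
Implicit Types (K : {subfield L}) (x t : L) (rs : seq L).

Fixpoint sqrt_tower K rs : Prop :=
  if rs is x :: rs' then x ^+ 2 \in K /\ sqrt_tower <<K; x>>%AS rs' else True.

Fixpoint strict_tower K rs : Prop :=
  if rs is x :: rs' then x \notin K /\ strict_tower <<K; x>>%AS rs' else True.

Lemma dim_strict_tower K rs : sqrt_tower K rs -> strict_tower K rs ->
  \dim <<K & rs>> = (2 ^ size rs * \dim K)%N.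
Proof.
elim: rs K => [|x rs IHrs] K /=; first by rewrite Fadjoin_nil mul1n.
move=> [Kx2 tw] [Kx stw]; rewrite adjoin_cons (IHrs <<K; x>>%AS) //.
by rewrite dim_adjoin_sqrt // mulnA expnS (mulnC 2).
Qed.

(** Each [x] is a root of X^2 - x^2, whose roots [x] and [- x] differ when [x] is nonzero, the
    characteristic not being 2. *)
Lemma separable_tower K rs : (2%N \notin [pchar F]) -> sqrt_tower K rs ->
  separable K <<K & rs>>.
Proof.
move=> ch2; elim: rs K => [|x rs IHrs] K /=.
  by rewrite Fadjoin_nil => _; apply: separable_refl.
move=> [Kx2 tw]; rewrite adjoin_cons.
apply: (separable_trans _ (IHrs <<K; x>>%AS tw)); rewrite -adjoin_separable_eq.
have [->|x0] := eqVneq x 0; first by rewrite base_separable ?mem0v.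
apply/separable_elementP; exists (\prod_(t <- [:: x; - x]) ('X - t%:P)).
rewrite root_prod_XsubC mem_head separable_prod_XsubC /= inE eq_sym.
rewrite oppr_neq //; split=> //; rewrite !big_cons big_nil mulr1.
have -> : ('X - x%:P) * ('X - (- x)%:P) = 'X^2 - (x ^+ 2)%:P.
  by rewrite polyCN polyC_exp; ring.
by rewrite rpredB ?rpredX ?polyOverX ?polyOverC.
Qed.

(** Write [t = c0 + c1 * x]. As [t ^+ 2] is in [K], so is [2 c0 c1 x]; hence [c0] or [c1] vanishes
    unless [x] already lies in [K]. *)
Lemma sqrt_in_quadratic K x t : 2%N \notin [pchar F] ->
  x ^+ 2 \in K -> t ^+ 2 \in K -> t \in <<K; x>>%VS -> t \in K \/ t * x \in K.
Proof.
move=> ch2 Kx2 Kt2 Kxt; have [Kx|nKx] := boolP (x \in K).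
  by left; move/Fadjoin_idP: Kx Kxt => ->.
pose p := Fadjoin_poly K x t; have Kp : p \is a polyOver K := Fadjoin_polyOver K x t.
have tE : t = p`_0 + p`_1 * x.
  rewrite -{1}(Fadjoin_poly_eq Kxt) -/p (@horner_coef_wide _ 2).
    by rewrite big_ord_recl big_ord1 /= expr0 mulr1 expr1.
  exact: leq_trans (size_Fadjoin_poly _ _ _) (adjoin_degree_sqrt Kx2).
have [K0 K1] : p`_0 \in K /\ p`_1 \in K by split; apply: (polyOverP Kp).
move: (p`_0) (p`_1) K0 K1 tE => c0 c1 K0 K1 tE.
have [c1_0|c1_neq0] := eqVneq c1 0; first by left; rewrite tE c1_0 mul0r addr0.
have [c0_0|c0_neq0] := eqVneq c0 0.
  by right; rewrite tE c0_0 add0r -mulrA -expr2 rpredM.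
case/negP: nKx; have n2 := two_neq0 L ch2.
have -> : x = (t ^+ 2 - c0 ^+ 2 - c1 ^+ 2 * x ^+ 2) / (2%:R * c0 * c1).
  by rewrite tE; field; rewrite c1_neq0 c0_neq0 n2.
apply: rpred_div; last by rewrite !rpredM ?rpred_nat.
apply: rpredB; last by rewrite rpredM // rpredX.
by apply: rpredB => //; rewrite rpredX.
Qed.

End SquareRootTowers.

Lemma sqr_eq_sign (L : fieldType) (x y : L) :
  x ^+ 2 = y ^+ 2 -> exists2 e : L, e = 1 \/ e = -1 & x = e * y.
Proof.
move/eqP; rewrite eqf_sqr => /orP[] /eqP ->.
  by exists 1; [left | rewrite mul1r].
by exists (-1); [right | rewrite mulN1r].
Qed.

Definition sgn (L : fieldType) (e : L) := e = 1 \/ e = -1.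

Lemma sgn1 (L : fieldType) : sgn (1 : L). Proof. by left. Qed.
Lemma sgnN1 (L : fieldType) : sgn (-1 : L). Proof. by right. Qed.

Lemma sgnM (L : fieldType) (e f : L) : sgn e -> sgn f -> sgn (e * f).
Proof.
by move=> [] -> [] ->; rewrite ?mul1r ?mulN1r ?opprK; [left|right|right|left].
Qed.

Lemma sgn_sqr (L : fieldType) (e : L) : sgn e -> e * e = 1.
Proof. by case=> ->; rewrite ?mulrNN mulr1. Qed.

Lemma sgn_neq0 (L : fieldType) (e : L) : sgn e -> e != 0.
Proof. by case=> ->; rewrite ?oppr_eq0 oner_eq0. Qed.

Lemma rmorph_sgn (L : fieldType) (f : {rmorphism L -> L}) (e x : L) :
  sgn e -> f (e * x) = e * f x.
Proof. by case=> ->; rewrite ?mul1r ?mulN1r ?rmorphN. Qed.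

(** * The radical field and its automorphisms *)

Section RadicalTower.

Variables (F : fieldType) (L : splittingFieldType F).
Hypothesis ch2 : 2%N \notin [pchar F].
Variables (a u v : F) (r s s' g1 g2 om : L).
Hypotheses (r2 : r ^+ 2 = a%:A) (s2 : s ^+ 2 = u%:A + v%:A * r)
  (s'2 : s' ^+ 2 = u%:A - v%:A * r) (g12 : g1 ^+ 2 = 1 - s ^+ 2)
  (g22 : g2 ^+ 2 = 1 - s' ^+ 2) (om2 : om ^+ 2 = (1 - s) * (1 - s')).

Let b := u ^+ 2 - a * v ^+ 2.
Let c := (1 - u) ^+ 2 - a * v ^+ 2.
Let tb := s * s'.
Let tc := g1 * g2.
Hypotheses (b0 : b != 0) (c0 : c != 0).

Lemma tb2 : tb ^+ 2 = b%:A.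
Proof.
rewrite /tb exprMn s2 s'2 -[RHS]/(in_alg L _) /b rmorphB rmorphXn rmorphM rmorphXn /=.
by rewrite -r2; ring.
Qed.

Lemma tc2 : tc ^+ 2 = c%:A.
Proof.
rewrite /tc exprMn g12 g22 s2 s'2 -[RHS]/(in_alg L _) /c.
rewrite rmorphB rmorphXn rmorphB rmorph1 rmorphM rmorphXn /=.
by rewrite -r2; ring.
Qed.

Let tb0 : tb != 0.
Proof. by rewrite -sqrf_eq0 tb2 scaler_eq0 oner_eq0 orbF. Qed.
Let tc0 : tc != 0.
Proof. by rewrite -sqrf_eq0 tc2 scaler_eq0 oner_eq0 orbF. Qed.
Let s0 : s != 0. Proof. by move: tb0; rewrite mulf_eq0 negb_or => /andP[]. Qed.
Let g10 : g1 != 0. Proof. by move: tc0; rewrite mulf_eq0 negb_or => /andP[]. Qed.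
Let g20 : g2 != 0. Proof. by move: tc0; rewrite mulf_eq0 negb_or => /andP[]. Qed.
Let g1E : g1 ^+ 2 = (1 - s) * (1 + s). Proof. by rewrite g12; ring. Qed.
Let g2E : g2 ^+ 2 = (1 - s') * (1 + s'). Proof. by rewrite g22; ring. Qed.
Let sm0 : 1 - s != 0.
Proof. by apply: contra_neq g10 => e; apply/eqP; rewrite -sqrf_eq0 g1E e mul0r. Qed.
Let sp0 : 1 + s != 0.
Proof. by apply: contra_neq g10 => e; apply/eqP; rewrite -sqrf_eq0 g1E e mulr0. Qed.
Let s'm0 : 1 - s' != 0.
Proof. by apply: contra_neq g20 => e; apply/eqP; rewrite -sqrf_eq0 g2E e mul0r. Qed.
Let s'p0 : 1 + s' != 0.
Proof. by apply: contra_neq g20 => e; apply/eqP; rewrite -sqrf_eq0 g2E e mulr0. Qed.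
Let om0 : om != 0. Proof. by rewrite -sqrf_eq0 om2 mulf_neq0. Qed.

(** In this order each entry is a square root over the field generated by the earlier ones, the
    first three being square roots of scalars. The elements [s'] and [g2] are recovered as
    quotients. *)
Definition radicals := [:: r; s * s'; g1 * g2; s; g1; om].
Definition radical_field := <<1 & radicals>>%AS.
Notation M := radical_field.

Let Mrad x : x \in radicals -> x \in M. Proof. exact: seqv_sub_adjoin. Qed.
Lemma mem_r : r \in M. Proof. by apply: Mrad; rewrite !inE eqxx. Qed.
Lemma mem_s : s \in M. Proof. by apply: Mrad; rewrite !inE eqxx ?orbT. Qed.
Lemma mem_g1 : g1 \in M. Proof. by apply: Mrad; rewrite !inE eqxx ?orbT. Qed.
Lemma mem_om : om \in M. Proof. by apply: Mrad; rewrite !inE eqxx ?orbT. Qed.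
Lemma mem_tb : tb \in M. Proof. by apply: Mrad; rewrite !inE eqxx ?orbT. Qed.
Lemma mem_tc : tc \in M. Proof. by apply: Mrad; rewrite !inE eqxx ?orbT. Qed.
Lemma mem_s' : s' \in M.
Proof. by have -> : s' = tb / s by [rewrite /tb; field];
  rewrite rpred_div ?mem_tb ?mem_s. Qed.
Lemma mem_g2 : g2 \in M.
Proof. by have -> : g2 = tc / g1 by [rewrite /tc; field];
  rewrite rpred_div ?mem_tc ?mem_g1. Qed.
Let memM := (mem_r, mem_s, mem_s', mem_g1, mem_g2, mem_om, mem_tb, mem_tc).

Lemma sqrt_tower_radicals (K : {subfield L}) : sqrt_tower K radicals.
Proof.
have KA (E : {subfield L}) (k : F) : k%:A \in E by rewrite rpredZ ?rpred1.
rewrite /= -/tb -/tc r2 tb2 tc2 s2 g12 om2; split; first exact: KA.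
split; first exact: KA.
split; first exact: KA.
split.
  apply: rpredD (KA _ _) (rpredM (KA _ _) _).
  by do 2 apply: subvP_adjoin; apply: memv_adjoin.
split; first by rewrite rpredB ?rpred1 // rpredX // memv_adjoin.
split=> //; set E := (X in _ \in X).
have Es : s \in E by rewrite subvP_adjoin ?memv_adjoin.
have Etb : tb \in E by do 3 apply: subvP_adjoin; apply: memv_adjoin.
have Es' : s' \in E.
  by have -> : s' = tb / s by [rewrite /tb; field]; rewrite rpred_div.
by rewrite rpredM ?rpredB ?rpred1.
Qed.

(** All conjugates of [1 - s] lie in one square class of [M], since [g1], [om] and [g2] are square
    roots of products of two of them. *)
Let one_minus e : e \in [:: s; - s; s'; - s'] ->
  exists2 m, m \in M & 1 - e = (1 - s) * m ^+ 2.
Proof.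
have M1s : 1 - s \in M by rewrite rpredB ?rpred1 ?memM.
rewrite !inE => /or4P[] /eqP ->.
- by exists 1; rewrite ?rpred1 // expr1n mulr1.
- exists (g1 / (1 - s)); first by rewrite rpred_div ?memM.
  by rewrite expr_div_n g1E; field.
- exists (om / (1 - s)); first by rewrite rpred_div ?memM.
  by rewrite expr_div_n om2; field.
exists (g2 / om); first by rewrite rpred_div ?memM.
by rewrite expr_div_n g2E om2; field; rewrite sm0 s'm0.
Qed.

Lemma conj_r (f : 'AEnd(L)) : f r = r \/ f r = - r.
Proof.
have : (f r) ^+ 2 == r ^+ 2 by rewrite -rmorphXn /= r2 rmorph_alg.
by rewrite eqf_sqr => /orP[] /eqP; [left | right].
Qed.

Lemma conj_fix (f : 'AEnd(L)) : f r = r ->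
  [/\ f (s ^+ 2) = s ^+ 2, f (s' ^+ 2) = s' ^+ 2, f (g1 ^+ 2) = g1 ^+ 2
    & f (g2 ^+ 2) = g2 ^+ 2].
Proof.
move=> fr.
have fs : f (s ^+ 2) = s ^+ 2.
  by rewrite s2 rmorphD rmorphM /= !rmorph_alg fr.
have fs' : f (s' ^+ 2) = s' ^+ 2.
  by rewrite s'2 rmorphB rmorphM /= !rmorph_alg fr.
by split=> //; rewrite (g12, g22) rmorphB rmorph1 /= (fs, fs').
Qed.

Lemma conj_move (f : 'AEnd(L)) : f r = - r ->
  [/\ f (s ^+ 2) = s' ^+ 2, f (s' ^+ 2) = s ^+ 2, f (g1 ^+ 2) = g2 ^+ 2
    & f (g2 ^+ 2) = g1 ^+ 2].
Proof.
move=> fr.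
have fs : f (s ^+ 2) = s' ^+ 2.
  by rewrite s2 s'2 rmorphD rmorphM /= !rmorph_alg fr mulrN.
have fs' : f (s' ^+ 2) = s ^+ 2.
  by rewrite s2 s'2 rmorphB rmorphM /= !rmorph_alg fr mulrN opprK.
by split=> //; rewrite (g12, g22) rmorphB rmorph1 /= (fs, fs') (g12, g22).
Qed.

(** For normality, an automorphism of [L] permutes the elements [s], [s'], [g1], [g2] up to sign,
    and sends [om ^+ 2] to a product of two conjugates of [1 - s], which is a square in [M] by
    [one_minus]. *)
Lemma galois_radical_field : galois 1 M.
Proof.
apply/and3P; split; first exact: sub1v.
  by apply: separable_tower => //; apply: sqrt_tower_radicals.
apply/forall_inP => f _.
suff : kAut 1 M f by case/andP.
rewrite kAut1E /= aimg_adjoin_seq aimg1; apply/Fadjoin_seqP.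
split; first exact: sub1v.
have sgnM x y : x ^+ 2 = y ^+ 2 -> y \in M -> x \in M.
  by move=> /sqr_eq_sign[e [] -> ->] My; rewrite ?mul1r ?mulN1r ?rpredN.
have sqr_mem x y : f (x ^+ 2) = y ^+ 2 -> f x = y \/ f x = - y.
  rewrite rmorphXn /= => /sqr_eq_sign[e [] -> ->].
    by left; rewrite mul1r.
  by right; rewrite mulN1r.
have [fs fs' fg1 fg2] : [/\ f s \in [:: s; - s; s'; - s'],
    f s' \in [:: s; - s; s'; - s'], f g1 \in M & f g2 \in M].
  have [/conj_fix[e1 e2 e3 e4]|/conj_move[e1 e2 e3 e4]] := conj_r f;
    split; do ?[by apply: (sgnM _ _ _ mem_g1); rewrite -rmorphXn
               |by apply: (sgnM _ _ _ mem_g2); rewrite -rmorphXn].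
  - by case: (sqr_mem _ _ e1) => ->; rewrite !inE eqxx ?orbT.
  - by case: (sqr_mem _ _ e2) => ->; rewrite !inE eqxx ?orbT.
  - by case: (sqr_mem _ _ e1) => ->; rewrite !inE eqxx ?orbT.
  - by case: (sqr_mem _ _ e2) => ->; rewrite !inE eqxx ?orbT.
have Ms e : e \in [:: s; - s; s'; - s'] -> e \in M.
  by rewrite !inE => /or4P[] /eqP ->; rewrite ?rpredN memM.
have fom : f om \in M.
  have [m Mm mE] := one_minus fs; have [m' Mm' mE'] := one_minus fs'.
  apply: (sgnM _ ((1 - s) * m * m')); last first.
    by rewrite !rpredM ?rpredB ?rpred1 ?memM.
  by rewrite -rmorphXn /= om2 rmorphM !rmorphB !rmorph1 /= mE mE'; ring.
have fr : f r \in M.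
  by case: (conj_r f) => ->; rewrite ?rpredN memM.
move=> x; rewrite /= !inE => /or4P[||| /or3P[]] /eqP ->; rewrite ?rmorphM //=.
- by rewrite rpredM ?Ms.
- by rewrite rpredM.
- exact: Ms.
Qed.

Implicit Types g h X Y Z P Q : gal_of M.

Lemma gal_ext g h : g r = h r -> g s = h s -> g s' = h s' ->
  g g1 = h g1 -> g g2 = h g2 -> g om = h om -> g = h.
Proof.
move=> er es es' eg1 eg2 eom; apply/eqP/gal_eqP => x Mx.
have sub : (M <= lker (ahval g - ahval h))%VS.
  apply/Fadjoin_seqP; split.
    apply/subvP=> _ /vlineP[k ->]; rewrite memv_ker !lfunE /= !lfunE /=.
    by rewrite !rmorph_alg subrr.
  move=> y; rewrite memv_ker !lfunE /= !lfunE /= subr_eq0.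
  by rewrite !inE => /or4P[||| /or3P[]] /eqP ->;
    rewrite ?rmorphM /= ?er ?es ?es' ?eg1 ?eg2 ?eom.
have := subvP sub x Mx; rewrite memv_ker !lfunE /= !lfunE /= subr_eq0.
by move/eqP.
Qed.

(** The action on [om] is left out: for given signs it is determined up to sign. *)
Definition diag g (e1 e2 k1 k2 : L) :=
  [/\ g r = r, g s = e1 * s, g s' = e2 * s', g g1 = k1 * g1 & g g2 = k2 * g2].

(** Using the same [e] twice makes [tb] fixed, while [t] is the sign of the action on [tc]. *)
Definition move g (e t k : L) :=
  [/\ g r = - r, g s = e * s', g s' = e * s, g g1 = k * g2 & g g2 = t * k * g1].

Let gal_sgn g (e x : L) : sgn e -> g (e * x) = e * g x.
Proof. exact: rmorph_sgn. Qed.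

Let sgn_conj g (x y : L) : g (x ^+ 2) = y ^+ 2 -> exists2 e : L, sgn e & g x = e * y.
Proof. by rewrite rmorphXn => /sqr_eq_sign. Qed.

Let sgn_solve (e e' t x : L) : sgn e -> x != 0 -> e * e' * x = t * x -> e' = t * e.
Proof.
move=> se x0 /(mulIf x0) <-.
by rewrite mulrAC (sgn_sqr se) mul1r.
Qed.

(** [g] acts by a sign on each of [s], [s'], [g1], [g2], whose squares it fixes; its signs on [tb]
    and [tc] tie those on [s'] and [g2] to those on [s] and [g1]. *)
Lemma act_fix g (t1 t2 : L) : g r = r -> g tb = t1 * tb -> g tc = t2 * tc ->
  exists e k : L, [/\ sgn e, sgn k & diag g e (t1 * e) k (t2 * k)].
Proof.
move=> gr gtb gtc; have [qs qs' q1 q2] := conj_fix gr.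
have [e se es] := sgn_conj qs; have [e' se' es'] := sgn_conj qs'.
have [k sk ek] := sgn_conj q1; have [k' sk' ek'] := sgn_conj q2.
exists e, k; split=> //; split=> //.
  rewrite es'; congr (_ * _); apply: (sgn_solve se tb0); rewrite -gtb.
  by rewrite /tb rmorphM /= es es'; ring.
rewrite ek'; congr (_ * _); apply: (sgn_solve sk tc0); rewrite -gtc.
by rewrite /tc rmorphM /= ek ek'; ring.
Qed.

Lemma act_move g (t : L) : g r = - r -> g tb = tb -> g tc = t * tc ->
  exists e k : L, [/\ sgn e, sgn k & move g e t k].
Proof.
move=> gr gtb gtc; have [qs qs' q1 q2] := conj_move gr.
have [e se es] := sgn_conj qs; have [e' se' es'] := sgn_conj qs'.
have [k sk ek] := sgn_conj q1; have [k' sk' ek'] := sgn_conj q2.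
exists e, k; split=> //; split=> //.
  rewrite es'; congr (_ * _); rewrite -[RHS]mul1r.
  apply: (sgn_solve se tb0); rewrite mul1r -{2}gtb.
  by rewrite /tb rmorphM /= es es'; ring.
rewrite ek'; congr (_ * _); apply: (sgn_solve sk tc0); rewrite -gtc.
by rewrite /tc rmorphM /= ek ek'; ring.
Qed.

(** Products of automorphisms apply the left factor first, so this is [X * Y = Y * X * [~ X, Y]]
    evaluated at [x]. *)
Lemma commg_act X Y x : x \in M -> Y (X x) = [~ X, Y]%g (X (Y x)).
Proof. by move=> Mx; rewrite -(galM X Y) // commgC !galM ?memv_gal. Qed.

(** [X] exchanges [s] and [s'] up to sign, and the signs of [Y] on them differ by [t1]; the
    commutator therefore multiplies both by [t1]. Likewise for [g1], [g2] and [t2]. *)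
Lemma comm_diag X Y (e t k f t1 l t2 : L) :
    sgn e -> sgn k -> sgn t -> sgn f -> sgn l -> sgn t1 -> sgn t2 ->
    move X e t k -> diag Y f (t1 * f) l (t2 * l) ->
  diag [~ X, Y]%g t1 t1 t2 t2.
Proof.
move=> se sk st sf sl st1 st2 [Xr Xs Xs' X1 X2] [Yr Ys Ys' Y1 Y2].
have Er := commg_act X Y mem_r; rewrite Xr Yr Xr !rmorphN /= Yr in Er.
have Es := commg_act X Y mem_s.
rewrite Xs Ys !gal_sgn // Ys' Xs gal_sgn // in Es.
have Es' := commg_act X Y mem_s'.
have st1f := sgnM st1 sf; have st2l := sgnM st2 sl; have stk := sgnM st sk.
rewrite Xs' Ys' !gal_sgn // Ys Xs' gal_sgn // in Es'.
have E1 := commg_act X Y mem_g1.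
rewrite X1 Y1 !gal_sgn // Y2 X1 gal_sgn // in E1.
have E2 := commg_act X Y mem_g2.
rewrite X2 Y2 !gal_sgn // Y1 X2 gal_sgn // in E2.
split.
- by apply: oppr_inj.
- apply: (mulfI (sgn_neq0 (sgnM st1f se))); rewrite -[LHS]mulrA -Es'.
  by rewrite -[LHS]mul1r -(sgn_sqr st1); ring.
- by apply: (mulfI (sgn_neq0 (sgnM sf se))); rewrite -[LHS]mulrA -Es; ring.
- apply: (mulfI (sgn_neq0 (sgnM st2l stk))); rewrite -[LHS]mulrA -E2.
  by rewrite -[LHS]mul1r -(sgn_sqr st2); ring.
- by apply: (mulfI (sgn_neq0 (sgnM sl sk))); rewrite -[LHS]mulrA -E1; ring.
Qed.

Lemma diagM g h (e1 e2 k1 k2 f1 f2 l1 l2 : L) :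
    sgn e1 -> sgn e2 -> sgn k1 -> sgn k2 ->
    diag g e1 e2 k1 k2 -> diag h f1 f2 l1 l2 ->
  diag (g * h)%g (e1 * f1) (e2 * f2) (k1 * l1) (k2 * l2).
Proof.
move=> se1 se2 sk1 sk2 [gr gs gs' gg1 gg2] [hr hs hs' hg1 hg2].
by split; rewrite galM ?memM // (gr, gs, gs', gg1, gg2) ?gal_sgn // ?(hr, hs, hs',
  hg1, hg2) ?mulrA.
Qed.

Lemma moveM X P (e t k f l : L) :
    sgn e -> sgn t -> sgn k -> move X e t k -> diag P f f l l ->
  move (X * P)%g (e * f) t (k * l).
Proof.
move=> se st sk [Xr Xs Xs' X1 X2] [Pr Ps Ps' P1 P2]; have stk := sgnM st sk.
split; rewrite galM ?memM //.
- by rewrite Xr rmorphN /= Pr.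
- by rewrite Xs gal_sgn // Ps' mulrA.
- by rewrite Xs' gal_sgn // Ps mulrA.
- by rewrite X1 gal_sgn // P2 mulrA.
- by rewrite X2 gal_sgn // P1 !mulrA.
Qed.

Section Normalisation.

Variables P Q : gal_of M.
Hypotheses (actP : diag P (-1) (-1) 1 1) (actQ : diag Q 1 1 (-1) (-1)).

(** Multiplying by [P] changes the sign [e], and multiplying by [Q] changes the sign [k]. *)
Lemma normalise_move X (e t k : L) : sgn e -> sgn t -> sgn k -> move X e t k ->
  exists X', move X' 1 t 1.
Proof.
move=> se st sk mX.
have [X1 mX1] : exists X1, move X1 1 t k.
  case: se mX => -> mX; first by exists X.
  exists (X * P)%g; have := moveM (sgnN1 L) st sk mX actP.
  by rewrite mulrNN !mulr1.
case: sk mX1 => -> mX1; first by exists X1.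
exists (X1 * Q)%g; have := moveM (sgn1 L) st (sgnN1 L) mX1 actQ.
by rewrite mulrNN !mulr1.
Qed.

Lemma normalise_diag g (e k t1 t2 f l : L) :
    sgn e -> sgn k -> sgn t1 -> sgn t2 -> sgn f -> sgn l ->
    diag g e (t1 * e) k (t2 * k) ->
  exists g', diag g' f (t1 * f) l (t2 * l).
Proof.
move=> se sk st1 st2 sf sl dg.
have [h dh] : exists h, diag h f (t1 * f) k (t2 * k).
  have [fe|fe] : f = e \/ f = - e.
    by case: se => ->; case: sf => ->; rewrite ?opprK; by [left | right].
  - by exists g; rewrite fe.
  exists (g * P)%g; rewrite fe; have := diagM se (sgnM st1 se) sk (sgnM st2 sk) dg actP.
  by rewrite !mulrN !mulr1.
have [le|le] : l = k \/ l = - k.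
  by case: sk => ->; case: sl => ->; rewrite ?opprK; by [left | right].
- by exists h; rewrite le.
exists (h * Q)%g; rewrite le; have := diagM sf (sgnM st1 sf) sk (sgnM st2 sk) dh actQ.
by rewrite !mulrN !mulr1.
Qed.

End Normalisation.

Lemma om_move X (t : L) : move X 1 t 1 -> exists2 e : L, sgn e & X om = e * om.
Proof.
move=> [_ Xs Xs' _ _]; apply: sgn_conj; rewrite om2 rmorphM !rmorphB rmorph1 /=.
by rewrite Xs Xs'; ring.
Qed.

Lemma om_fix g (k1 k2 : L) : diag g 1 1 k1 k2 -> exists2 e : L, sgn e & g om = e * om.
Proof.
move=> [_ gs gs' _ _]; apply: sgn_conj; rewrite om2 rmorphM !rmorphB rmorph1 /=.
by rewrite gs gs'; ring.
Qed.

(** The image of [om ^+ 2] is [(1 + s) * (1 - s')], and [1 + s] is [g1 ^+ 2 / (1 - s)]. *)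
Lemma om_neg Y : diag Y (-1) 1 1 1 ->
  exists2 e : L, sgn e & Y om = e * (om * g1 / (1 - s)).
Proof.
move=> [_ Ys Ys' _ _]; apply: sgn_conj; rewrite om2 rmorphM !rmorphB rmorph1 /=.
by rewrite Ys Ys' expr_div_n exprMn om2 g1E; field.
Qed.

(** Compute [Y (X om)] through the commutator: the unknown signs of [X] and [Y] on [om] occur on
    both sides and cancel, so the value is exact. *)
Lemma om_commg X Y (t : L) : move X 1 t 1 -> diag Y (-1) 1 1 1 ->
    diag [~ X, Y]%g (-1) (-1) 1 1 ->
  [~ X, Y]%g om = om * (g1 * g2 / ((1 - s) * (1 - s'))).
Proof.
move=> mX dY dP; have [e se Xom] := om_move mX; have [f sf Yom] := om_neg dY.
have := commg_act X Y mem_om.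
rewrite Xom Yom [Y (e * _)]gal_sgn // [X (f * _)]gal_sgn // [_ (f * X _)]gal_sgn // Yom.
case: mX => _ Xs _ X1 _; case: dP => _ _ Ps' _ P2.
rewrite !rmorphM !fmorphV !rmorphB !rmorph1 /= Xom X1 Xs !mul1r gal_sgn // P2 Ps'
  mul1r mulN1r opprK.
set Pom := [~ X, Y]%g om => E.
have efn := mulf_neq0 (sgn_neq0 se) (sgn_neq0 sf).
apply: (mulfI efn); apply: (mulIf g20); apply: (mulIf (invr_neq0 s'p0)).
have -> : e * f * Pom * g2 / (1 + s') = f * (e * Pom * g2 / (1 + s')).
  by field.
rewrite -E; have -> : 1 + s' = g2 ^+ 2 / (1 - s') by rewrite g2E; field.
by field; rewrite sm0 s'm0 g20.
Qed.

(** Such a [w] is trivial or changes the sign of [om] alone; this makes the nontrivial one unique,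
    hence central in the group. *)
Definition central w := diag w 1 1 1 1.

Lemma central_om w : central w -> w != 1%g -> w om = - om.
Proof.
move=> cw; have [e [] ->] := om_fix cw; rewrite ?mulN1r // mul1r => wom.
case/eqP; case: cw => wr ws ws' w1 w2.
by apply: gal_ext; rewrite gal_id ?wr ?ws ?ws' ?w1 ?w2 ?mul1r.
Qed.

Lemma central_uniq w w' : central w -> central w' -> w != 1%g -> w' != 1%g -> w = w'.
Proof.
move=> cw cw' nw nw'; have := central_om cw nw; have := central_om cw' nw'.
case: cw => wr ws ws' w1 w2; case: cw' => wr' vs vs' v1 v2 wo' wo.
by apply: gal_ext; rewrite ?wr ?ws ?ws' ?w1 ?w2 ?wo ?wr' ?vs ?vs' ?v1 ?v2 ?wo'.
Qed.

Lemma central_conj w g : central w -> central (w ^ g)%g.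
Proof.
move=> [wr ws ws' w1 w2].
have key x : x \in M -> w (g^-1%g x) = g^-1%g x -> (w ^ g)%g x = 1 * x.
  move=> Mx fx; rewrite conjgE !galM ?memv_gal // fx mul1r.
  by rewrite -galM // mulVg gal_id.
have [fr|mr] := conj_r g^-1%g.
  have [qs qs' q1 q2] := conj_fix fr.
  have [[e1 se1 es] [e2 se2 es']] := (sgn_conj qs, sgn_conj qs').
  have [[e3 se3 eg1] [e4 se4 eg2]] := (sgn_conj q1, sgn_conj q2).
  by split; [rewrite -[RHS]mul1r|..]; apply: key;
    rewrite ?memM // ?fr ?wr // (es, es', eg1, eg2) gal_sgn // (ws, ws', w1, w2) mul1r.
have [qs qs' q1 q2] := conj_move mr.
have [[e1 se1 es] [e2 se2 es']] := (sgn_conj qs, sgn_conj qs').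
have [[e3 se3 eg1] [e4 se4 eg2]] := (sgn_conj q1, sgn_conj q2).
split; [rewrite -[RHS]mul1r|..]; apply: key; rewrite ?memM // ?mr ?rmorphN /= ?wr //;
  by rewrite (es, es', eg1, eg2) gal_sgn // (ws, ws', w1, w2) mul1r.
Qed.

Lemma central_commg w g : central w -> w != 1%g -> [~ w, g]%g = 1%g.
Proof.
move=> cw nw; apply/eqP/conjg_fixP.
by apply: central_uniq => //; [apply: central_conj | rewrite conjg_eq1].
Qed.

Lemma central_sqr w : central w -> (w ^+ 2)%g = 1%g.
Proof.
move=> cw; have [-> | nw] := eqVneq w 1%g; first by rewrite expg1n.
have wom := central_om cw nw; case: cw => wr ws ws' w1 w2.
by apply: gal_ext; rewrite expg2 galM ?memM // gal_id ?wr ?ws ?ws' ?w1 ?w2 ?mul1r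
  ?ws ?ws' ?w1 ?w2 ?mul1r // wom rmorphN /= wom opprK.
Qed.

(** On [om] the sign from [om_neg] is squared away, and [g1 ^+ 2] cancels [(1 - s) * (1 + s)]. *)
Lemma diag_sqr Y : diag Y (-1) 1 1 1 -> (Y ^+ 2)%g = 1%g.
Proof.
move=> dY; have [e se Yom] := om_neg dY; case: dY => Yr Ys Ys' Y1 Y2.
apply: gal_ext; rewrite expg2 galM ?memM // gal_id.
- by rewrite !Yr.
- by rewrite Ys mulN1r rmorphN /= Ys; ring.
- by rewrite !(Ys', mul1r).
- by rewrite !(Y1, mul1r).
- by rewrite !(Y2, mul1r).
rewrite Yom gal_sgn // !rmorphM fmorphV rmorphB rmorph1 /= Yom Y1 Ys mul1r mulN1r opprK.
have -> : e * (e * (om * g1 / (1 - s)) * g1 / (1 + s))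
        = (e * e) * (om * g1 ^+ 2 / ((1 - s) * (1 + s))).
  by field; rewrite sm0 sp0.
by rewrite (sgn_sqr se) g1E; field; rewrite sm0 sp0.
Qed.

Lemma commg_sqr P : diag P (-1) (-1) 1 1 ->
    P om = om * (g1 * g2 / ((1 - s) * (1 - s'))) -> (P ^+ 2)%g = 1%g.
Proof.
move=> [Pr Ps Ps' P1 P2] Pom.
apply: gal_ext; rewrite expg2 galM ?memM // gal_id.
- by rewrite !Pr.
- by rewrite Ps mulN1r rmorphN /= Ps; ring.
- by rewrite Ps' mulN1r rmorphN /= Ps'; ring.
- by rewrite !(P1, mul1r).
- by rewrite !(P2, mul1r).
rewrite Pom !rmorphM fmorphV rmorphM !rmorphB !rmorph1 /= Pom P1 P2 Ps Ps' !mul1r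
  !mulN1r !opprK.
have -> : om * (g1 * g2 / ((1 - s) * (1 - s'))) * (g1 * g2 / ((1 + s) * (1 + s')))
   = om * g1 ^+ 2 * g2 ^+ 2 / ((1 - s) * (1 - s') * (1 + s) * (1 + s')).
  by field; rewrite sm0 sp0 s'm0 s'p0.
by rewrite g1E g2E; field; rewrite sm0 sp0 s'm0 s'p0.
Qed.

Hypothesis a0 : a != 0.
Let r0 : r != 0.
Proof. by rewrite -sqrf_eq0 r2 scaler_eq0 oner_eq0 orbF. Qed.

Lemma commg_noncommute g h x :
  x \in M -> g (h x) != 0 -> h (g x) = - g (h x) -> [~ g, h]%g != 1%g.
Proof.
move=> Mx nz e; apply/eqP => gh1; have := commg_act g h Mx.
by rewrite gh1 gal_id e => /eqP; rewrite (negPf (oppr_neq ch2 nz)).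
Qed.

(** Sign changes of [s], [s'], [g1], [g2] commute, so the commutator can only act on [om]. *)
Lemma comm_diag2 g h (e1 e2 k1 k2 f1 f2 l1 l2 : L) :
    sgn e1 -> sgn e2 -> sgn k1 -> sgn k2 -> sgn f1 -> sgn f2 -> sgn l1 -> sgn l2 ->
    diag g e1 e2 k1 k2 -> diag h f1 f2 l1 l2 -> central [~ g, h]%g.
Proof.
move=> se1 se2 sk1 sk2 sf1 sf2 sl1 sl2 [gr gs gs' gg1 gg2] [hr hs hs' hg1 hg2].
have key x (e f : L) : x \in M -> sgn e -> sgn f -> g x = e * x -> h x = f * x ->
    [~ g, h]%g x = 1 * x.
  move=> Mx se sf gx hx; have := commg_act g h Mx.
  rewrite gx hx [h (e * x)]gal_sgn // [g (f * x)]gal_sgn // hx gx.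
  rewrite [_ (f * (e * x))]gal_sgn // [_ (e * x)]gal_sgn // => E.
  apply: (mulfI (sgn_neq0 sf)); apply: (mulfI (sgn_neq0 se)).
  by rewrite mulrCA -E; ring.
split; last 4 first.
- by apply: key gs hs; rewrite ?memM.
- by apply: key gs' hs'; rewrite ?memM.
- by apply: key gg1 hg1; rewrite ?memM.
- by apply: key gg2 hg2; rewrite ?memM.
by rewrite -[RHS]mul1r; apply: (key _ 1 1); rewrite ?memM ?mul1r //; apply: sgn1.
Qed.

Lemma gal_fix_r g : g r = r -> g \in 'Gal(M / <<1; r>>)%g.
Proof.
move=> gr; rewrite gal_kHom; last by apply/FadjoinP; rewrite sub1v memM.
apply/kAHomP => t rt; apply/fixedSpaceP; apply: subvP rt.
apply/(@FadjoinP _ _ _ _ [aspace of fixedSpace g]); split.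
  by apply/subvP=> _ /vlineP[k ->]; apply/fixedSpaceP; rewrite rmorph_alg.
exact/fixedSpaceP.
Qed.

Definition fixes g (K : {vspace L}) := {in K, forall t, g t = t}.

Lemma fixes_adjoin g (K : {subfield L}) x : fixes g K -> g x = x -> fixes g <<K; x>>%VS.
Proof.
move=> fK fx t tK; apply/fixedSpaceP; apply: subvP tK.
apply/(@FadjoinP _ _ _ _ [aspace of fixedSpace g]); split; last exact/fixedSpaceP.
by apply/subvP=> y Ky; apply/fixedSpaceP/fK.
Qed.

Lemma moves_notin g (K : {vspace L}) x : fixes g K -> g x != x -> x \notin K.
Proof. by move=> fK; apply: contra => Kx; rewrite fK. Qed.

(** By the Galois correspondence some automorphism over [N] moves [x], and its only other possible
    value is [- x]. *)
Lemma gal_lift (N : {subfield L}) x (k : F) :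
    (N <= M)%VS -> x \in M -> x \notin N -> x ^+ 2 = k%:A ->
  exists2 g : gal_of M, fixes g N & g x = - x.
Proof.
move=> sNM Mx Nx x2.
have gN : galois N M by apply: galoisS galois_radical_field; rewrite sub1v.
have : x \notin fixedField 'Gal(M / N)%g by move/galois_fixedField: gN => ->.
have [/forall_inP fx|] := boolP [forall g in 'Gal(M / N)%g, g x == x].
  by case/negP; apply/fixedFieldP => // g Gg; apply/eqP/fx.
rewrite negb_forall_in => /exists_inP[g Gg gx] _; exists g.
  by move=> t Nt; apply: (fixed_gal sNM Gg).
by case: (gal_sqr_sign g x2) gx => [->|//]; rewrite eqxx.
Qed.

Let opN (x : L) : x != 0 -> - x != x. Proof. exact: oppr_neq. Qed.

(** * Realisation of G_2 *)

Section G2_relations.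

Variables X Y Z : gal_of M.
Hypotheses (mX : move X 1 1 1) (dY : diag Y (-1) 1 1 1) (dZ : diag Z 1 1 1 (-1)).

Let P := [~ X, Y]%g.
Let Q := [~ X, Z]%g.
Let W := [~ Y, Q]%g.
Let s1 := sgn1 L.
Let sN := sgnN1 L.

Lemma diagP : diag P (-1) (-1) 1 1.
Proof.
apply: (comm_diag s1 s1 s1 sN s1 sN s1 mX).
by rewrite mulrNN !mulr1.
Qed.

Lemma diagQ : diag Q 1 1 (-1) (-1).
Proof.
apply: (comm_diag s1 s1 s1 s1 s1 s1 sN mX).
by rewrite !mulr1.
Qed.

Lemma omP : P om = om * (g1 * g2 / ((1 - s) * (1 - s'))).
Proof. exact: om_commg mX dY diagP. Qed.

Lemma centralW : central W.
Proof. by have := comm_diag2 sN s1 s1 s1 s1 s1 sN sN dY diagQ. Qed.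

(** [Y om] carries the factor [g1], whose sign [Q] changes, so [Y] and [Q] do not commute on
    [om]. *)
Lemma W_neq1 : W != 1%g.
Proof.
have [e se Yom] := om_neg dY; have [f sf Qom] := om_fix diagQ.
have [_ Qs _ Q1 _] := diagQ.
have zz : Q (Y om) = - Y (Q om).
  rewrite Qom [Y (f * om)]gal_sgn // Yom [Q (e * _)]gal_sgn //.
  by rewrite !rmorphM fmorphV rmorphB rmorph1 /= Qom Q1 Qs mul1r; ring.
apply: (commg_noncommute mem_om _ zz).
by rewrite !fmorph_eq0.
Qed.

Lemma G2_relXYZ : G2_rel X Y Z.
Proof.
have [e se Xom] := om_move mX; have [f sf Yom] := om_neg dY.
have [l sl Zom] := om_fix dZ; have [m sm Qom] := om_fix diagQ.
have [Xr Xs Xs' X1 X2] := mX; have [Yr Ys Ys' Y1 Y2] := dY.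
have [Zr Zs Zs' Z1 Z2] := dZ; have [Qr Qs Qs' Q1 Q2] := diagQ.
have [Pr Ps Ps' P1 P2] := diagP.
rewrite !mul1r in Xs Xs' X1 X2 Ys' Y1 Y2 Zs Zs' Z1 Qs Qs' P1 P2.
have xx : (X ^+ 2)%g = 1%g.
  apply: gal_ext; rewrite expg2 galM ?memM // gal_id.
  - by rewrite Xr rmorphN /= Xr opprK.
  - by rewrite Xs.
  - by rewrite Xs'.
  - by rewrite X1.
  - by rewrite X2.
  by rewrite Xom [X _]gal_sgn // Xom mulrA sgn_sqr // mul1r.
have zz : (Z ^+ 2)%g = 1%g.
  apply: gal_ext; rewrite expg2 galM ?memM // gal_id.
  - by rewrite !Zr.
  - by rewrite !Zs.
  - by rewrite !Zs'.
  - by rewrite !Z1.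
  - by rewrite Z2 mulN1r rmorphN /= Z2 mulN1r opprK.
  by rewrite Zom [Z _]gal_sgn // Zom mulrA sgn_sqr // mul1r.
have qq : (Q ^+ 2)%g = 1%g.
  apply: gal_ext; rewrite expg2 galM ?memM // gal_id.
  - by rewrite !Qr.
  - by rewrite !Qs.
  - by rewrite !Qs'.
  - by rewrite Q1 mulN1r rmorphN /= Q1 mulN1r opprK.
  - by rewrite Q2 mulN1r rmorphN /= Q2 mulN1r opprK.
  by rewrite Qom [Q _]gal_sgn // Qom mulrA sgn_sqr // mul1r.
have yz : [~ Y, Z]%g = 1%g.
  apply/eqP/commgP; apply: gal_ext; rewrite !galM ?memM //.
  - by rewrite Yr Zr Yr.
  - by rewrite Zs Ys !mulN1r !rmorphN /= Zs.
  - by rewrite Zs' Ys' Zs'.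
  - by rewrite Z1 Y1 Z1.
  - by rewrite Y2 Z2 !mulN1r !rmorphN /= Y2.
  rewrite Zom Yom [Z (f * _)]gal_sgn // [Y (l * _)]gal_sgn // Yom.
  by rewrite !rmorphM fmorphV rmorphB rmorph1 /= Zom Z1 Zs; ring.
have zp_neq1 : [~ Z, P]%g != 1%g.
  have e' : P (Z om) = - Z (P om).
    rewrite Zom [P (l * _)]gal_sgn // omP.
    by rewrite !rmorphM fmorphV rmorphM !rmorphB rmorph1 /= Zom Z1 Z2 Zs Zs'; ring.
  by apply: (commg_noncommute mem_om _ e'); rewrite !fmorph_eq0.
(* Both sides are nontrivial and act only on [om], so they coincide; this is the mixed relation of
   G_2. *)
have zp : W = [~ Z, P]%g.
  apply: central_uniq => //; first exact: centralW; last exact: W_neq1.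
  exact: comm_diag2 s1 s1 s1 sN sN sN s1 s1 dZ diagP.
have cW := centralW; have nW := W_neq1.
rewrite /G2_rel -/P -/Q -/W xx (diag_sqr dY) zz (commg_sqr diagP omP) qq yz -zp.
by rewrite (central_sqr cW) !central_commg // !eqxx.
Qed.

(** The tower stays strict over [K]: [X], [Y], [Z], [P], [Q], [W] move [r], [tb], [tc], [s], [g1],
    [om] in turn, and each fixes [K] and the earlier radicals. The general [K] serves
    [gen_of_dim]. *)
Lemma G2_dim (K : {subfield L}) : (K <= M)%VS ->
    X \in 'Gal(M / K)%g -> Y \in 'Gal(M / K)%g -> Z \in 'Gal(M / K)%g ->
  \dim M = (64 * \dim K)%N.
Proof.
move=> sKM GX GY GZ.
have GQ : Q \in 'Gal(M / K)%g by rewrite groupR.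
have fK g : g \in 'Gal(M / K)%g -> fixes g K.
  by move=> Gg t Kt; apply: (fixed_gal sKM Gg).
have -> : \dim M = \dim <<K & radicals>>.
  congr (\dim _); apply/eqP; rewrite eqEsubv; apply/andP; split.
    by apply/Fadjoin_seqP; split; [apply: sub1v | apply: seqv_sub_adjoin].
  by apply/Fadjoin_seqP; split=> //; apply: seqv_sub_adjoin.
rewrite dim_strict_tower //; first exact: sqrt_tower_radicals.
have [Xr Xs Xs' X1 X2] := mX; have [Yr Ys Ys' Y1 Y2] := dY.
have [Zr Zs Zs' Z1 Z2] := dZ; have [Qr Qs Qs' Q1 Q2] := diagQ.
have [Pr Ps Ps' P1 P2] := diagP; have [Wr Ws Ws' W1 W2] := centralW.
rewrite !mul1r in Xs Xs' X1 X2 Ys' Y1 Y2 Zs Zs' Z1 Qs Qs' P1 P2 Ws Ws' W1 W2.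
rewrite !mulN1r in Ys Z2 Q1 Q2 Ps Ps'.
have Yb : Y tb = - tb by rewrite rmorphM /= Ys Ys' mulNr.
have Zb : Z tb = tb by rewrite rmorphM /= Zs Zs'.
have Pb : P tb = tb by rewrite rmorphM /= Ps Ps' mulrNN.
have Qb : Q tb = tb by rewrite rmorphM /= Qs Qs'.
have Wb : W tb = tb by rewrite rmorphM /= Ws Ws'.
have Zc : Z tc = - tc by rewrite rmorphM /= Z1 Z2 mulrN.
have Pc : P tc = tc by rewrite rmorphM /= P1 P2.
have Qc : Q tc = tc by rewrite rmorphM /= Q1 Q2 mulrNN.
have Wc : W tc = tc by rewrite rmorphM /= W1 W2.
have Wo := central_om centralW W_neq1.
have fP : fixes P K by apply: fK; rewrite groupR.
have fQ : fixes Q K by apply: fK.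
have fW : fixes W K by apply: fK; rewrite groupR.
split; first by apply: (moves_notin (fK _ GX)); rewrite Xr opN.
split; first by apply: (moves_notin (fixes_adjoin (fK _ GY) Yr)); rewrite Yb opN.
split.
  by apply: (moves_notin (fixes_adjoin (fixes_adjoin (fK _ GZ) Zr) Zb)); rewrite Zc opN.
split.
  by apply: (moves_notin (fixes_adjoin (fixes_adjoin (fixes_adjoin fP Pr) Pb) Pc));
    rewrite Ps opN.
split.
  by apply: (moves_notin (fixes_adjoin (fixes_adjoin (fixes_adjoin (fixes_adjoin fQ
    Qr) Qb) Qc) Qs)); rewrite Q1 opN.
split=> //.
by apply: (moves_notin (fixes_adjoin (fixes_adjoin (fixes_adjoin (fixes_adjoin
  (fixes_adjoin fW Wr) Wb) Wc) Ws) W1)); rewrite Wo opN.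
Qed.

End G2_relations.

Lemma gal_of_mem g : g \in 'Gal(M / 1)%g.
Proof. by rewrite gal_kHom ?sub1v // k1AHom. Qed.

(** Compare the degree formula for the base field with the one for the fixed field of [A]: that
    fixed field must be the base, so [A] generates. *)
Lemma gen_of_dim (A : {set gal_of M}) n : (0 < n)%N ->
    (forall K : {subfield L}, (K <= M)%VS -> A \subset 'Gal(M / K)%g ->
       \dim M = (n * \dim K)%N) ->
  <<A>>%g = 'Gal(M / 1)%g /\ #|'Gal(M / 1)%g| = n.
Proof.
move=> n0 dimK; have sA : A \subset 'Gal(M / 1)%g.
  by apply/subsetP=> g _; apply: gal_of_mem.
have d1 : \dim M = n by rewrite (dimK 1%AS) ?sub1v // dimv1 muln1.
split; last by rewrite -(galois_dim galois_radical_field) dimv1 divn1.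
rewrite -gal_generated; congr ('Gal(M / _)%g); apply/esym/eqP.
rewrite eqEdim sub1v dimv1 -(leq_pmul2l n0) muln1.
have dA := dimK [aspace of fixedField A] (fixedField_bound A)
  (galois_connection_subset A).
by rewrite -dA d1 leqnn.
Qed.

Section G2_realisation.

Variables X Y Z : gal_of M.
Hypotheses (mX : move X 1 1 1) (dY : diag Y (-1) 1 1 1) (dZ : diag Z 1 1 1 (-1)).

Lemma G2_realised :
  <<[set X; Y; Z]>>%g = 'Gal(M / 1)%g /\ #|'Gal(M / 1)%g| = 64.
Proof.
apply: gen_of_dim => // K sKM /subsetP sA.
by apply: (G2_dim mX dY dZ) => //; apply: sA; rewrite !inE eqxx ?orbT.
Qed.

Lemma G2_isog : ~ is_square a ->
  ('Gal(M / <<1; r>>) \isog DD)%g /\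
  ('Gal(M / 1%VS) \isog Grp (x : y : z :
           (x ^+ 2, y ^+ 2, z ^+ 2, [~ x, y] ^+ 2, [~ x, z] ^+ 2, [~ y, z],
            [~ y, [~ x, z]] = [~ z, [~ x, y]],
            [~ y, [~ x, z]] ^+ 2,
            [~ y, [~ x, z], x], [~ y, [~ x, z], y], [~ y, [~ x, z], z])))%g.
Proof.
move=> nsq; have [genG oG] := G2_realised; have rel := G2_relXYZ mX dY dZ.
split; last by rewrite -[galoisG _ _]genG; apply: isog_G2 => //; rewrite genG oG.
have srM : (<<1; r>> <= M)%VS by apply/FadjoinP; rewrite sub1v memM.
apply: (G2_core_isog_DD rel) => //.
- by rewrite genG oG.
- have galr : galois <<1; r>> M by apply: galoisS galois_radical_field; rewrite sub1v.
  rewrite -(galois_dim galr) dim_adjoin_sqrt ?dimv1 ?(sqrt_scalar nsq r2) //.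
    by move: oG; rewrite -(galois_dim galois_radical_field) dimv1 divn1 => ->.
  by rewrite r2 rpredZ ?rpred1.
- by apply: gal_fix_r; case: dY.
- by apply: gal_fix_r; case: dZ.
- by apply: gal_fix_r; case: (diagP mX dY).
- by apply: gal_fix_r; case: (diagQ mX dZ).
Qed.

End G2_realisation.

(** * Realisation of G_1 *)

Section G1_relations.

Variables X Y : gal_of M.
Hypotheses (mX : move X 1 (-1) 1) (dY : diag Y (-1) 1 1 1).
Variable k : F.
Hypothesis tcr : tc = k%:A * r.

Let P := [~ X, Y]%g.
Let W := [~ X, P]%g.
Let s1 := sgn1 L.
Let sN := sgnN1 L.

Let dP : diag P (-1) (-1) 1 1.
Proof.
apply: (comm_diag s1 s1 sN sN s1 sN s1 mX).
by rewrite mulrNN !mulr1.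
Qed.

Let Pom : P om = om * (g1 * g2 / ((1 - s) * (1 - s'))).
Proof. exact: om_commg mX dY dP. Qed.

Let cW : central W.
Proof.
apply: (comm_diag s1 s1 sN sN s1 s1 s1 mX).
by rewrite !mul1r.
Qed.

(** [P om] carries the factor [g1 * g2], whose sign [X] changes. *)
Let nW : W != 1%g.
Proof.
have [e se Xom] := om_move mX; have [_ Xs Xs' X1 X2] := mX.
have e' : P (X om) = - X (P om).
  rewrite Xom [P (e * _)]gal_sgn // Pom.
  rewrite !rmorphM fmorphV rmorphM !rmorphB rmorph1 /= Xom X1 X2 Xs Xs'.
  by rewrite mulr1 !mul1r [(1 - s') * _]mulrC; ring.
by apply: (commg_noncommute mem_om _ e'); rewrite !fmorph_eq0.
Qed.

(** [X ^+ 2] takes the place of the commutator [Q] of the other case. *)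
Let dX2 : diag (X ^+ 2)%g 1 1 (-1) (-1).
Proof.
have [Xr Xs Xs' X1 X2] := mX; rewrite !mul1r in Xs Xs' X1; rewrite mulr1 in X2.
split; rewrite expg2 galM ?memM //.
- by rewrite Xr rmorphN /= Xr opprK.
- by rewrite Xs Xs' mul1r.
- by rewrite Xs' Xs mul1r.
- by rewrite X1 X2.
- by rewrite X2 mulN1r rmorphN /= X1 mulN1r.
Qed.

Lemma G1_relXY : G1_rel X Y.
Proof.
have [e se Xom] := om_move mX.
have X2om : (X ^+ 2)%g om = om.
  by rewrite expg2 galM ?memM // Xom [X _]gal_sgn // Xom mulrA sgn_sqr // mul1r.
have x4 : (X ^+ 4)%g = 1%g.
  have [Qr Qs Qs' Q1 Q2] := dX2; rewrite -[4%N]/(2 * 2)%N expgM.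
  rewrite !mul1r in Qs Qs'.
  apply: gal_ext; rewrite expg2 galM ?memM // gal_id.
  - by rewrite !Qr.
  - by rewrite !Qs.
  - by rewrite !Qs'.
  - by rewrite Q1 mulN1r rmorphN /= Q1 mulN1r opprK.
  - by rewrite Q2 mulN1r rmorphN /= Q2 mulN1r opprK.
  by rewrite !X2om.
have wE : [~ P, X]%g = W by rewrite -invgR -/W; apply/invg_involution/central_sqr.
rewrite /G1_rel -/P wE x4 (diag_sqr dY) (commg_sqr dP Pom) (central_sqr cW).
by rewrite !central_commg // !eqxx.
Qed.

Let gens5 := [:: r; tb; s; g1; om].

(** Here [tc] is a scalar multiple of [r] and leaves the tower. The five remaining radicals are
    moved in turn by [X], [Y], [P], [X ^+ 2] and [W]. *)
Lemma G1_dim (K : {subfield L}) : (K <= M)%VS ->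
  [set X; Y] \subset 'Gal(M / K)%g -> \dim M = (32 * \dim K)%N.
Proof.
move=> sKM /subsetP sA.
have GX : X \in 'Gal(M / K)%g by apply: sA; rewrite !inE eqxx.
have GY : Y \in 'Gal(M / K)%g by apply: sA; rewrite !inE eqxx orbT.
have GX2 : (X ^+ 2)%g \in 'Gal(M / K)%g by rewrite groupX.
have fK g : g \in 'Gal(M / K)%g -> fixes g K.
  by move=> Gg t Kt; apply: (fixed_gal sKM Gg).
have KA (E : {subfield L}) (l : F) : l%:A \in E by rewrite rpredZ ?rpred1.
have -> : \dim M = \dim <<K & gens5>>.
  congr (\dim _); apply/eqP; rewrite eqEsubv; apply/andP; split.
    have s5 x : x \in gens5 -> x \in <<K & gens5>>%VS by apply: seqv_sub_adjoin.
    apply/Fadjoin_seqP; split; first exact: sub1v.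
    move=> x; rewrite !inE => /or4P[||| /or3P[]] /eqP ->;
      do ?[by apply: s5; rewrite !inE eqxx ?orbT].
    rewrite -/tc tcr; apply: rpredM; first exact: KA.
    by apply: s5; rewrite !inE eqxx.
  apply/Fadjoin_seqP; split=> // x.
  by rewrite !inE => /or4P[||| /orP[]] /eqP ->; rewrite ?memM.
have tw : sqrt_tower K gens5.
  rewrite /= r2 tb2 s2 g12 om2; split; first exact: KA.
  split; first exact: KA.
  split.
    apply: rpredD (KA _ _) (rpredM (KA _ _) _).
    by apply: subvP_adjoin; apply: memv_adjoin.
  split; first by rewrite rpredB ?rpred1 // rpredX // memv_adjoin.
  split=> //; set E := (E in _ \in E).
  have Es : s \in E by rewrite subvP_adjoin ?memv_adjoin.
  have Etb : tb \in E by do 2 apply: subvP_adjoin; apply: memv_adjoin.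
  have Es' : s' \in E.
    by have -> : s' = tb / s by [rewrite /tb; field]; rewrite rpred_div.
  by rewrite rpredM ?rpredB ?rpred1.
rewrite dim_strict_tower //.
have [Xr _ _ _ _] := mX; have [Yr Ys Ys' _ _] := dY.
have [Qr Qs Qs' Q1 _] := dX2.
have [Pr Ps Ps' _ _] := dP; have [Wr Ws Ws' W1 _] := cW.
rewrite !mul1r in Ys' Qs Qs' Ws Ws' W1.
rewrite !mulN1r in Ys Q1 Ps Ps'.
have Yb : Y tb = - tb by rewrite rmorphM /= Ys Ys' mulNr.
have Pb : P tb = tb by rewrite rmorphM /= Ps Ps' mulrNN.
have Qb : (X ^+ 2)%g tb = tb by rewrite rmorphM /= Qs Qs'.
have Wb : W tb = tb by rewrite rmorphM /= Ws Ws'.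
have Wo := central_om cW nW.
have GP : P \in 'Gal(M / K)%g by rewrite groupR.
have fW : fixes W K by apply: fK; rewrite groupR.
split; first by apply: (moves_notin (fK _ GX)); rewrite Xr opN.
split; first by apply: (moves_notin (fixes_adjoin (fK _ GY) Yr)); rewrite Yb opN.
split.
  by apply: (moves_notin (fixes_adjoin (fixes_adjoin (fK _ GP) Pr) Pb)); rewrite Ps opN.
split.
  by apply: (moves_notin (fixes_adjoin (fixes_adjoin (fixes_adjoin (fK _ GX2) Qr) Qb)
    Qs)); rewrite Q1 opN.
split=> //.
by apply: (moves_notin (fixes_adjoin (fixes_adjoin (fixes_adjoin (fixes_adjoin fW Wr)
  Wb) Ws) W1)); rewrite Wo opN.
Qed.

(** [E] is the fixed field of [G1_kernel], whose generators fix [r]. The kernel has order at most 8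
    in a group of order 32, so the quotient generated by the coset of [X] has order at least 4,
    while [X ^+ 4] is trivial. *)
Lemma G1_isog :
  exists E : {subfield L}, [/\ (<<1; r>> <= E)%VS, (E <= M)%VS, galois 1 E,
     ('Gal(E / 1%VS) \isog Grp (x : x ^+ 4))%g
   & ('Gal(M / 1%VS) \isog Grp (x : y :
           (x ^+ 4, y ^+ 2, [~ x, y] ^+ 2, [~ x, y, x] ^+ 2,
            [~ x, y, x, x], [~ x, y, x, y])))%g].
Proof.
have [genG oG] := gen_of_dim (isT : (0 < 32)%N) G1_dim.
have rel := G1_relXY; have [oN Nx gE _] := G1_kernel_bounds rel.
pose N := [group of G1_kernel X Y].
have galM1 := galois_radical_field.
have Ny : Y \in N by rewrite mem_gen ?setU11.
have nsN : (N <| 'Gal(M / 1))%g.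
  rewrite /normal -genG; apply/andP; split.
    by rewrite genG; apply/subsetP=> g _; apply: gal_of_mem.
  by rewrite gen_subG; apply/subsetP=> g /set2P[] -> //; rewrite (subsetP (normG N)).
pose E := [aspace of fixedField N].
have sEM : (E <= M)%VS by apply: fixedField_bound.
have galE : galois 1 E by apply: normal_fixedField_galois.
exists E; split=> //.
- apply/FadjoinP; split; first exact: sub1v.
  have sNr : N \subset 'Gal(M / <<1; r>>)%g.
    rewrite gen_subG; apply/subsetP=> g.
    case/setU1P=> [->|/setU1P[->|/set1P->]]; apply: gal_fix_r.
    + by case: dY.
    + by case: dP.
    by rewrite -/P -invgR -/W; rewrite (invg_involution (central_sqr cW)); case: cW.
  apply/fixedFieldP; first exact: mem_r.
  move=> g /(subsetP sNr) Gg; apply: (fixed_gal _ Gg); last exact: memv_adjoin.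
  by apply/FadjoinP; rewrite sub1v memM.
- have sKEM : (1 <= E <= M)%VS by rewrite sub1v.
  have nE : normalField 1 E by case/and3P: galE.
  have iso := normalField_isog galM1 sKEM nE.
  rewrite isog_sym in iso; apply: (isoGrp_trans iso).
  rewrite gal_fixedField.
  have GNE : ('Gal(M / 1) / N = <[coset N X]>)%g.
    rewrite -genG gE; have -> : <<X |: G1_kernel X Y>>%g = (N <*> <[X]>)%g.
      by rewrite joing_idr setUC.
    by rewrite quotientYidl ?cycle_subG // /quotient morphim_cycle.
  rewrite /= GNE; apply: isog_C4.
    by rewrite -morphX //; case/andP: rel => /eqP -> _; rewrite morph1.
  have := card_quotient (normal_norm nsN); rewrite GNE => oX.
  rewrite [#[_]%g]oX -(leq_pmul2l (cardG_gt0 N)) Lagrange ?normal_sub // oG.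
  exact: (leq_mul oN (leqnn 4)).
rewrite -[galoisG _ _]genG; apply: isog_G1 => //.
by rewrite genG oG.
Qed.

End G1_relations.

(** * Independence of square classes and lifting of sign changes *)

Let sqrM (x y : L) (kx ky : F) :
  x ^+ 2 = kx%:A -> y ^+ 2 = ky%:A -> (x * y) ^+ 2 = (kx * ky)%:A.
Proof. by move=> ex ey; rewrite exprMn ex ey -[RHS]/(in_alg L _) rmorphM. Qed.

Let scalar_mem (K : {subfield L}) (k : F) : k%:A \in K.
Proof. by rewrite rpredZ ?rpred1. Qed.

Lemma notin_adjoin1 (x y : L) (kx ky : F) :
    x ^+ 2 = kx%:A -> y ^+ 2 = ky%:A -> ~ is_square kx -> ~ is_square (kx * ky) ->
  x \notin <<1; y>>%VS.
Proof.
move=> ex ey nx nxy; apply/negP => xy.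
have [||xin|xin] := @sqrt_in_quadratic _ _ 1%AS y x ch2 _ _ xy.
- by rewrite ey scalar_mem.
- by rewrite ex scalar_mem.
- by have := sqrt_scalar nx ex; rewrite xin.
by have := sqrt_scalar nxy (sqrM ex ey); rewrite xin.
Qed.

Lemma notin_adjoin2 (x y z : L) (kx ky kz : F) :
    x ^+ 2 = kx%:A -> y ^+ 2 = ky%:A -> z ^+ 2 = kz%:A ->
    ~ is_square kx -> ~ is_square (kx * ky) -> ~ is_square (kx * kz) ->
    ~ is_square (kx * kz * ky) ->
  x \notin <<<<1; y>>; z>>%VS.
Proof.
move=> ex ey ez nx nxy nxz nxyz; apply/negP => xyz.
have [||xin|xin] := @sqrt_in_quadratic _ _ <<1; y>>%AS z x ch2 _ _ xyz.
- by rewrite ez scalar_mem.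
- by rewrite ex scalar_mem.
- by have := notin_adjoin1 ex ey nx nxy; rewrite xin.
by have := notin_adjoin1 (sqrM ex ez) ey nxz nxyz; rewrite xin.
Qed.

(** Independence modulo squares lets the sign changes of [r], [tb] and [tc] be lifted separately.
    The commutators of the lifts supply the [P] and [Q] that correct the remaining signs. *)
Lemma G2_exists :
    ~ is_square a -> ~ is_square b -> ~ is_square c -> ~ is_square (a * b) ->
    ~ is_square (a * c) -> ~ is_square (b * c) -> ~ is_square (a * b * c) ->
  exists X Y Z, [/\ move X 1 1 1, diag Y (-1) 1 1 1 & diag Z 1 1 1 (-1)].
Proof.
move=> na nb nc nab nac nbc nabc.
have [nba nca ncb] : [/\ ~ is_square (b * a), ~ is_square (c * a)
    & ~ is_square (c * b)] by rewrite ![_ * a]mulrC [c * b]mulrC.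
have [nacb nbca ncba] : [/\ ~ is_square (a * c * b), ~ is_square (b * c * a)
    & ~ is_square (c * b * a)].
  by rewrite [c * b]mulrC [b * c * a]mulrC mulrA [a * c * b]mulrAC.
have sub2 x y : x \in M -> y \in M -> (<<<<1; x>>; y>> <= M)%VS.
  by move=> Mx My; apply/FadjoinP; split=> //; apply/FadjoinP; rewrite sub1v.
have mem2 (x y : L) : x \in <<<<1; x>>; y>>%VS by apply/subvP_adjoin/memv_adjoin.
have [X0 fX Xr] : exists2 g, fixes g <<<<1; tb>>; tc>>%VS & g r = - r.
  apply: (gal_lift _ mem_r _ r2); first by rewrite sub2 ?memM.
  by apply: (notin_adjoin2 r2 tb2 tc2).
have [Y0 fY Yb] : exists2 g, fixes g <<<<1; r>>; tc>>%VS & g tb = - tb.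
  apply: (gal_lift _ mem_tb _ tb2); first by rewrite sub2 ?memM.
  by apply: (notin_adjoin2 tb2 r2 tc2).
have [Z0 fZ Zc] : exists2 g, fixes g <<<<1; r>>; tb>>%VS & g tc = - tc.
  apply: (gal_lift _ mem_tc _ tc2); first by rewrite sub2 ?memM.
  by apply: (notin_adjoin2 tc2 r2 tb2).
have Xb : X0 tb = tb by apply: fX; apply: mem2.
have Xc : X0 tc = 1 * tc by rewrite mul1r; apply: fX; apply: memv_adjoin.
have Yr : Y0 r = r by apply: fY; apply: mem2.
have Yc : Y0 tc = 1 * tc by rewrite mul1r; apply: fY; apply: memv_adjoin.
have Zr : Z0 r = r by apply: fZ; apply: mem2.
have Zb : Z0 tb = 1 * tb by rewrite mul1r; apply: fZ; apply: memv_adjoin.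
rewrite -[- tb]mulN1r in Yb; rewrite -[- tc]mulN1r in Zc.
have s1 := sgn1 L; have sN := sgnN1 L.
have [e [k [se sk mX]]] := act_move Xr Xb Xc.
have [f [l [sf sl dY]]] := act_fix Yr Yb Yc.
have [f' [l' [sf' sl' dZ]]] := act_fix Zr Zb Zc.
have dP := comm_diag se sk s1 sf sl sN s1 mX dY.
have dQ := comm_diag se sk s1 sf' sl' s1 sN mX dZ.
have [X mX'] := normalise_move dP dQ se s1 sk mX.
have [Y dY'] := normalise_diag dP dQ sf sl sN s1 sN s1 dY.
have [Z dZ'] := normalise_diag dP dQ sf' sl' s1 sN s1 s1 dZ.
exists X, Y, Z; split=> //; first by move: dY'; rewrite mulrNN !mulr1.
by move: dZ'; rewrite !mulr1.
Qed.

(** Only [r] and [tb] are independent. As [tc] is a multiple of [r], moving [r] negates it, whence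
    the sign -1 in [move]; the square of the first lift serves as [Q]. *)
Lemma G1_exists (k : F) : c = a * k ^+ 2 ->
    ~ is_square a -> ~ is_square b -> ~ is_square (a * b) ->
  (exists l : F, tc = l%:A * r) /\
  exists X Y, move X 1 (-1) 1 /\ diag Y (-1) 1 1 1.
Proof.
move=> cE na nb nab.
have [l tcr] : exists l : F, tc = l%:A * r.
  have : tc ^+ 2 = (k%:A * r) ^+ 2.
    rewrite tc2 cE exprMn r2 -[LHS]/(in_alg L _) rmorphM rmorphXn /=.
    by rewrite mulrC.
  case/sqr_eq_sign=> e [] -> ->; first by exists k; rewrite mul1r.
  by exists (- k); rewrite scaleNr !mulNr mul1r.
split; first by exists l.
have [X0 fX Xr] : exists2 g, fixes g <<1; tb>>%VS & g r = - r.
  apply: (gal_lift _ mem_r _ r2); first by apply/FadjoinP; rewrite sub1v memM.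
  exact: notin_adjoin1 r2 tb2 na nab.
have [Y0 fY Yb] : exists2 g, fixes g <<1; r>>%VS & g tb = - tb.
  apply: (gal_lift _ mem_tb _ tb2); first by apply/FadjoinP; rewrite sub1v memM.
  by apply: notin_adjoin1 tb2 r2 nb _; rewrite mulrC.
have Xb : X0 tb = tb by apply: fX; apply: memv_adjoin.
have Xc : X0 tc = -1 * tc by rewrite tcr rmorphM /= rmorph_alg Xr; ring.
have Yr : Y0 r = r by apply: fY; apply: memv_adjoin.
have Yc : Y0 tc = 1 * tc by rewrite tcr rmorphM /= rmorph_alg Yr mul1r.
rewrite -[- tb]mulN1r in Yb.
have s1 := sgn1 L; have sN := sgnN1 L.
have [e [j [se sj mX]]] := act_move Xr Xb Xc.
have [f [i [sf si dY]]] := act_fix Yr Yb Yc.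
have dP := comm_diag se sj sN sf si sN s1 mX dY.
have dQ : diag (X0 ^+ 2)%g 1 1 (-1) (-1).
  have [_ Xs Xs' X1 X2] := mX; have sNj := sgnM sN sj.
  split; rewrite expg2 galM ?memM //.
  - by rewrite Xr rmorphN /= Xr opprK.
  - by rewrite Xs gal_sgn // Xs' mulrA sgn_sqr.
  - by rewrite Xs' gal_sgn // Xs mulrA sgn_sqr.
  - by rewrite X1 gal_sgn // X2 mulrA mulN1r mulrN sgn_sqr.
  - by rewrite X2 gal_sgn // X1 mulrA mulN1r mulNr sgn_sqr.
have [X mX'] := normalise_move dP dQ se sN sj mX.
have [Y dY'] := normalise_diag dP dQ sf si sN s1 sN s1 dY.
by exists X, Y; split=> //; move: dY'; rewrite mulrNN !mulr1.
Qed.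

End RadicalTower.

(** * Square classes and rigidity *)

Section SquareClasses.

Variables (F : fieldType) (a : F).
Hypotheses (ch2 : 2%N \notin [pchar F]) (a0 : a != 0).
Hypotheses (na : ~ is_square a) (nma : ~ is_square (- a)).

Lemma nonsquare_neq0 (x : F) : ~ is_square x -> x != 0.
Proof. by move=> nx; apply/eqP => x0; apply: nx; exists 0; rewrite x0 expr0n. Qed.

Lemma nonsquare_scale (x f y : F) :
  f != 0 -> y = x * f ^+ 2 -> ~ is_square x -> ~ is_square y.
Proof.
move=> f0 yE nx [k yk]; apply: nx; exists (k / f).
by rewrite expr_div_n -yk yE; field.
Qed.

(* Solve f (u1 + v1 sqrt a) + g (u2 + v2 sqrt a) = 1 with f and g in F. *)
Lemma norms_summing_to_one (u1 v1 u2 v2 b c : F) :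
    b = u1 ^+ 2 - a * v1 ^+ 2 -> c = u2 ^+ 2 - a * v2 ^+ 2 ->
    ~ is_square b -> ~ is_square c -> ~ is_square (b * c) ->
  exists u v f g, [/\ f != 0, g != 0, u ^+ 2 - a * v ^+ 2 = b * f ^+ 2
    & (1 - u) ^+ 2 - a * v ^+ 2 = c * g ^+ 2].
Proof.
move=> bE cE nb nc nbc.
(* [v1] and [v2] are the numerators of [g] and [f] up to sign, which must be nonzero. *)
have v10 : v1 != 0.
  by apply/eqP => v0; apply: nb; exists u1; rewrite bE v0; ring.
have v20 : v2 != 0.
  by apply/eqP => v0; apply: nc; exists u2; rewrite cE v0; ring.
(* If the determinant vanishes, the two elements of norms [b] and [c] are proportional over [F], so
   [b * c] is a square. *)
have [D0|D0] := eqVneq (u1 * v2 - u2 * v1) 0.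
  case: nbc; exists (v1 * c / v2).
  have e : u1 = u2 * v1 / v2 by rewrite -[u2 * v1](subrK (u1 * v2)) -opprB D0; field.
  by rewrite bE e cE; field.
(* Cramer's rule for [f u1 + g u2 = 1] and [f v1 + g v2 = 0]. *)
pose f := v2 / (u1 * v2 - u2 * v1); pose g := - v1 / (u1 * v2 - u2 * v1).
exists (f * u1), (f * v1), f, g; split.
- by rewrite mulf_neq0 ?invr_eq0.
- by rewrite mulf_neq0 ?invr_eq0 ?oppr_eq0.
- by rewrite bE; ring.
by rewrite cE /f /g; field.
Qed.

Lemma G1_from_norms (u1 v1 u2 v2 b : F) :
    b = u1 ^+ 2 - a * v1 ^+ 2 -> a = u2 ^+ 2 - a * v2 ^+ 2 ->
    ~ is_square b -> ~ is_square (a * b) ->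
  exists (L : splittingFieldType F) (r : L) (E M : {subfield L}),
       (r ^+ 2 = a%:A)%R /\ (<<1; r>> <= E)%VS /\ (E <= M)%VS /\
       galois 1%VS E /\ galois 1%VS M /\
       ('Gal(E / 1%VS) \isog Grp (x : x ^+ 4))%g /\
       ('Gal(M / 1%VS) \isog Grp (x : y :
           (x ^+ 4, y ^+ 2, [~ x, y] ^+ 2, [~ x, y, x] ^+ 2,
            [~ x, y, x, x], [~ x, y, x, y])))%g.
Proof.
move=> bE aE nb nab.
have [|u [v [f [g [f0 g0 uvE uvE']]]]] := norms_summing_to_one bE aE nb na.
  by rewrite mulrC.
have nb' := nonsquare_scale f0 uvE nb.
have nab' : ~ is_square (a * (u ^+ 2 - a * v ^+ 2)).
  by apply: (nonsquare_scale f0 _ nab); rewrite uvE mulrA.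
have c0 : (1 - u) ^+ 2 - a * v ^+ 2 != 0.
  exact: nonsquare_neq0 (nonsquare_scale g0 uvE' na).
have b0 := nonsquare_neq0 nb'.
have [L [r [s [s' [g1 [g2 [om [r2 s2 s'2 [g12 g22 om2]]]]]]]]] := radicals_exist a u v.
have [[k tcr] [X [Y [mX dY]]]] :=
  G1_exists ch2 r2 s2 s'2 g12 g22 om2 b0 c0 uvE' na nb' nab'.
have [E [srE sEM galE isoE isoM]] :=
  G1_isog ch2 r2 s2 s'2 g12 g22 om2 b0 c0 a0 mX dY tcr.
have galM1 := galois_radical_field ch2 r2 s2 s'2 g12 g22 om2 b0 c0.
by exists L, r, E, (radical_field r s s' g1 g2 om).
Qed.

Lemma G2_from_norms (u1 v1 u2 v2 b c : F) :
    b = u1 ^+ 2 - a * v1 ^+ 2 -> c = u2 ^+ 2 - a * v2 ^+ 2 ->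
    ~ is_square b -> ~ is_square c -> ~ is_square (a * b) -> ~ is_square (a * c) ->
    ~ is_square (b * c) -> ~ is_square (a * b * c) ->
  exists (L : splittingFieldType F) (r : L) (M : {subfield L}),
       (r ^+ 2 = a%:A)%R /\ (<<1; r>> <= M)%VS /\
       galois 1%VS M /\
       ('Gal(M / <<1; r>>) \isog DD)%g /\
       ('Gal(M / 1%VS) \isog Grp (x : y : z :
           (x ^+ 2, y ^+ 2, z ^+ 2, [~ x, y] ^+ 2, [~ x, z] ^+ 2, [~ y, z],
            [~ y, [~ x, z]] = [~ z, [~ x, y]],
            [~ y, [~ x, z]] ^+ 2,
            [~ y, [~ x, z], x], [~ y, [~ x, z], y], [~ y, [~ x, z], z])))%g.
Proof.
move=> bE cE nb nc nab nac nbc nabc.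
have [u [v [f [g [f0 g0 uvE uvE']]]]] := norms_summing_to_one bE cE nb nc nbc.
have fg0 : f * g != 0 by rewrite mulf_neq0.
have nb' := nonsquare_scale f0 uvE nb; have nc' := nonsquare_scale g0 uvE' nc.
have b0 := nonsquare_neq0 nb'; have c0 := nonsquare_neq0 nc'.
have [L [r [s [s' [g1 [g2 [om [r2 s2 s'2 [g12 g22 om2]]]]]]]]] := radicals_exist a u v.
have [||||X [Y [Z [mX dY dZ]]]] := G2_exists ch2 r2 s2 s'2 g12 g22 om2 b0 c0 na nb' nc'.
- by apply: (nonsquare_scale f0 _ nab); rewrite uvE mulrA.
- by apply: (nonsquare_scale g0 _ nac); rewrite uvE' mulrA.
- by apply: (nonsquare_scale fg0 _ nbc); rewrite uvE uvE'; ring.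
- by apply: (nonsquare_scale fg0 _ nabc); rewrite uvE uvE'; ring.
have [isoH isoM] := G2_isog ch2 r2 s2 s'2 g12 g22 om2 b0 c0 a0 mX dY dZ na.
have galM1 := galois_radical_field ch2 r2 s2 s'2 g12 g22 om2 b0 c0.
exists L, r, (radical_field r s s' g1 g2 om); do 2!split=> //.
by apply/FadjoinP; rewrite sub1v mem_r.
Qed.

(** The classes F^2 and -a F^2 always consist of norms, apart from 0, and the square conditions hold
    by hypothesis; only the inclusion of the norms in these classes can fail. *)
Lemma not_rigid_norm : ~ rigid (- a) ->
  exists u v, [/\ u ^+ 2 - a * v ^+ 2 != 0, ~ is_square (u ^+ 2 - a * v ^+ 2)
    & forall k, u ^+ 2 - a * v ^+ 2 <> - a * k ^+ 2].
Proof.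
move=> nrig; apply: NNPP => nex; apply: nrig.
split; first by rewrite oppr_eq0.
split=> //; split; first by rewrite opprK.
move=> d; split=> [[d0 [x1 [x2 dE]]] | [k [k0 dE]]]; last first.
  split; first by case: dE => ->; rewrite ?mulf_neq0 ?oppr_eq0 ?expf_neq0.
  by case: dE => ->; [exists k, 0 | exists 0, k]; ring.
have dE' : d = x1 ^+ 2 - a * x2 ^+ 2 by rewrite dE mulNr.
apply: NNPP => nk; apply: nex; exists x1, x2; rewrite -dE'; split=> //.
  move=> [k dk]; apply: nk; exists k; split; last by left.
  by move: d0; rewrite dk sqrf_eq0.
move=> k dk; apply: nk; exists k; split; last by right.
by move: d0; rewrite dk mulf_eq0 sqrf_eq0 negb_or => /andP[].
Qed.

End SquareClasses.

Theorem theorem5p2 (F : fieldType) (a : F) :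
  (2%N \notin [pchar F])%R ->
  a != 0%R -> ~ is_square a -> ~ is_square (- a)%R ->
  (~ rigid (- a)%R <->
   ((exists (L : splittingFieldType F) (r : L) (E M : {subfield L}),
       (r ^+ 2 = a%:A)%R /\ (<<1; r>> <= E)%VS /\ (E <= M)%VS /\
       galois 1%VS E /\ galois 1%VS M /\
       ('Gal(E / 1%VS) \isog Grp (x : x ^+ 4))%g /\
       ('Gal(M / 1%VS) \isog Grp (x : y :
           (x ^+ 4, y ^+ 2, [~ x, y] ^+ 2, [~ x, y, x] ^+ 2,
            [~ x, y, x, x], [~ x, y, x, y])))%g)
    \/
    (exists (L : splittingFieldType F) (r : L) (M : {subfield L}),
       (r ^+ 2 = a%:A)%R /\ (<<1; r>> <= M)%VS /\
       galois 1%VS M /\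
       ('Gal(M / <<1; r>>) \isog DD)%g /\
       ('Gal(M / 1%VS) \isog Grp (x : y : z :
           (x ^+ 2, y ^+ 2, z ^+ 2, [~ x, y] ^+ 2, [~ x, z] ^+ 2, [~ y, z],
            [~ y, [~ x, z]] = [~ z, [~ x, y]],
            [~ y, [~ x, z]] ^+ 2,
            [~ y, [~ x, z], x], [~ y, [~ x, z], y], [~ y, [~ x, z], z])))%g))).
Proof.
move=> ch2 a0 na nma; split; last first.
  case=> [[L [r [E [M [r2 [srE [sEM [gE [gM [iE iM]]]]]]]]]]|].
    exact: G1_not_rigid ch2 a0 na _ _ _ _ r2 srE sEM gE gM iE iM.
  case=> [L [r [M [r2 [srM [gM [iH iM]]]]]]].
  exact: G2_not_rigid ch2 a0 na _ _ _ r2 srM gM iH iM.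
case/(not_rigid_norm a0 na nma) => u [v [d0 nd nad]].
set d := _ - _ in d0 nd nad; have dE : d = u ^+ 2 - a * v ^+ 2 by [].
case: (classic (exists U V, -1 = U ^+ 2 - a * V ^+ 2)) => [[U [V m1E]]|nm1].
  (* As [- a] is the norm of sqrt a, so is [a], the product of [- a] and -1, a norm. *)
  left; have aE : a = (a * V) ^+ 2 - a * U ^+ 2.
    have -> : (a * V) ^+ 2 - a * U ^+ 2 = - a * (U ^+ 2 - a * V ^+ 2) by ring.
    by rewrite -m1E mulrN1 opprK.
  (* [b = d] works unless [a * d] is a square. Then [b = -1] does: were -1 a square, [d] would lie
     in -a F^2. *)
  case: (classic (is_square (a * d))) => [[k kE]|nadd].
    apply: (G1_from_norms ch2 a0 na m1E aE); last by rewrite mulrN1.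
    move=> [i iE]; apply: (nad (i * k / a)).
    have -> : - a * (i * k / a) ^+ 2 = - i ^+ 2 * k ^+ 2 / a by field.
    by rewrite -iE -kE opprK mul1r; field.
  exact: (G1_from_norms ch2 a0 na dE aE).
(* Take [b = d] and [c = - a], the norm of sqrt a. Every remaining coincidence of square classes
   makes -1 a norm or puts [d] in -a F^2. *)
right; have maE : - a = 0 ^+ 2 - a * 1 ^+ 2 by ring.
apply: (G2_from_norms ch2 a0 na dE maE) => //.
- move=> [k kE]; apply: nm1.
  have k0 : k != 0 by rewrite -sqrf_eq0 -kE mulf_neq0.
  (* These are the coordinates of sqrt a (u + v sqrt a) / k, of norm -a d / k^2. *)
  exists (v / (k / a)), (u / k).
  have -> : (v / (k / a)) ^+ 2 - a * (u / k) ^+ 2 = - (a * d) / k ^+ 2.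
    by rewrite dE; field; rewrite k0 a0.
  by rewrite kE mulNr divff ?sqrf_eq0.
- move=> [k kE]; apply: nm1; exists (k / a), 0; rewrite expr_div_n -kE.
  by field.
- move=> [k kE]; apply: (nad (k / a)); rewrite expr_div_n -kE.
  by field.
move=> [k kE]; apply: nm1.
have k0 : k != 0 by rewrite -sqrf_eq0 -kE !mulf_neq0 ?oppr_eq0.
(* These are the coordinates of a (u + v sqrt a) / k, of norm a^2 d / k^2. *)
exists (a * u / k), (a * v / k).
have -> : (a * u / k) ^+ 2 - a * (a * v / k) ^+ 2 = - (a * d * - a) / k ^+ 2.
  by rewrite dE; field.
by rewrite kE mulNr divff ?sqrf_eq0.
Qed.
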